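(* The following formulas define, for each generator $\xi$ of $\mathfrak d$, a derivation $\tilde\xi$ of $\mathfrak t_{\mathrm{ell}}^\Phi$, and the assignment $\xi\mapsto\tilde\xi$ is a Lie algebra homomorphism $\mathfrak d\to\mathrm{Der}(\mathfrak t_{\mathrm{ell}}^\Phi)$: for $u\in\mathfrak h$, $\alpha\in\Phi$, $m\ge1$, $$\tilde d(x(u))=x(u),\quad\tilde d(y(u))=-y(u),\quad\tilde d(t_\alpha)=0,$$ $$\tilde X(x(u))=0,\quad\tilde X(y(u))=x(u),\quad\tilde X(t_\alpha)=0,$$ $$\tilde\Delta_0(x(u))=y(u),\quad\tilde\Delta_0(y(u))=0,\quad\tilde\Delta_0(t_\alpha)=0,$$ $$\tilde\delta_{2m}(x(u))=0,\qquad\tilde\delta_{2m}(t_\alpha)=\Big[t_\alpha,\big(\mathrm{ad}\tfrac{x(\alpha^\vee)}2\big)^{2m}(t_\alpha)\Big],$$ $$\tilde\delta_{2m}(y(u))=\frac12\sum_{\alpha\in\Phi^+}\alpha(u)\sum_{p+q=2m-1}\Big[\big(\mathrm{ad}\tfrac{x(\alpha^\vee)}2\big)^p(t_\alpha),\big(-\mathrm{ad}\tfrac{x(\alpha^\vee)}2\big)^q(t_\alpha)\Big].$$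
   Context: $E$ is a Euclidean vector space, $\Phi\subset E^*$ a finite reduced crystallographic root system, $\Phi^+$ a system of positive roots, $\alpha^\vee$ the coroot of $\alpha$, $\mathfrak h=E\otimes_{\mathbb R}\mathbb C$. A root subsystem is a subset $\Psi\subset\Phi$ with $\mathbb Z\Psi\cap\Phi=\Psi$; $\Psi^+=\Psi\cap\Phi^+$. $\mathfrak t_{\mathrm{ell}}^\Phi$ is the complex Lie algebra generated by $t_\alpha$ ($\alpha\in\Phi$, $t_{-\alpha}=t_\alpha$) and linear maps $x,y:\mathfrak h\to\mathfrak t_{\mathrm{ell}}^\Phi$, with relations: $[t_\alpha,\sum_{\beta\in\Psi^+}t_\beta]=0$ for every rank 2 root subsystem $\Psi$ and $\alpha\in\Psi$; $[x(u),x(v)]=0=[y(u),y(v)]$; $[y(u),x(v)]=\sum_{\gamma\in\Phi^+}\langle v,\gamma\rangle\langle u,\gamma\rangle t_\gamma$; $[t_\alpha,x(u)]=0=[t_\alpha,y(u)]$ if $\alpha(u)=0$. $\mathfrak d$ is the Lie algebra with generators $\Delta_0,d,X,\delta_{2m}$ ($m\ge1$) and relations $[d,X]=2X$, $[d,\Delta_0]=-2\Delta_0$, $[X,\Delta_0]=d$, $[\delta_{2m},X]=0$, $[d,\delta_{2m}]=2m\,\delta_{2m}$, $(\mathrm{ad}\,\Delta_0)^{2m+1}(\delta_{2m})=0$. *)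

(* Defs.v *)
From HB Require Import structures.
From mathcomp Require Import all_boot all_order all_algebra.
From mathcomp Require Import finmap generic_quotient sesquilinear.
From mathcomp Require Import boolp functions reals.
From mathcomp Require Import complex.

Set Implicit Arguments.
Unset Strict Implicit.
Unset Printing Implicit Defensive.

Import Order.TTheory GRing.Theory Num.Theory.

Local Open Scope ring_scope.
Local Open Scope quotient_scope.
Local Open Scope complex_scope.

Reserved Notation "[br a , b ]" (at level 0, a, b at level 99,
  format "[br  a ,  b ]").

HB.mixin Record Lmodule_isLieAlgebra (K : fieldType) L of GRing.Lmodule K L := {
  liebr : L -> L -> L;
  liebr_linearl : forall b : L, linear (fun a : L => liebr a b);
  liebr_linearr : forall a : L, linear (liebr a);
  liebrxx : forall a : L, liebr a a = 0;
  liebr_jacobi : forall a b c : L,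
    liebr a (liebr b c) + liebr b (liebr c a) + liebr c (liebr a b) = 0
}.

#[short(type="lieAlgType")]
HB.structure Definition LieAlgebra (K : fieldType) :=
  {L of Lmodule_isLieAlgebra K L & GRing.Lmodule K L}.

Notation "[br a , b ]" := (liebr a b) : ring_scope.

Definition lie_morphism (K : fieldType) (L M : lieAlgType K) (f : L -> M) :=
  linear f /\ forall a b : L, f [br a, b] = [br f a, f b].

Section LieTheory.
Variables (K : fieldType) (L : lieAlgType K).
Implicit Types (a b c : L) (k : K).

Lemma liebrDl a b c : [br a + b, c] = [br a, c] + [br b, c].
Proof. by have := liebr_linearl c 1 a b; rewrite !scale1r. Qed.

Lemma liebrDr a b c : [br a, b + c] = [br a, b] + [br a, c].
Proof. by have := liebr_linearr a 1 b c; rewrite !scale1r. Qed.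

Lemma liebr0l a : [br 0, a] = 0.
Proof. by apply: (addrI [br 0, a]); rewrite -liebrDl !addr0. Qed.

Lemma liebr0r a : [br a, 0] = 0.
Proof. by apply: (addrI [br a, 0]); rewrite -liebrDr !addr0. Qed.

Lemma liebrZl k a b : [br k *: a, b] = k *: [br a, b].
Proof. by have := liebr_linearl b k a 0; rewrite liebr0l !addr0. Qed.

Lemma liebrZr k a b : [br a, k *: b] = k *: [br a, b].
Proof. by have := liebr_linearr a k b 0; rewrite liebr0r !addr0. Qed.

Lemma liebrNl a b : [br - a, b] = - [br a, b].
Proof. by rewrite -scaleN1r liebrZl scaleN1r. Qed.

Lemma liebrNr a b : [br a, - b] = - [br a, b].
Proof. by rewrite -scaleN1r liebrZr scaleN1r. Qed.

End LieTheory.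

Section Derivations.
Variables (K : fieldType) (L : lieAlgType K).

Definition is_derivation (D : L -> L) :=
  linear D /\ forall a b : L, D [br a, b] = [br D a, b] + [br a, D b].

Definition derivation_pred : {pred (L -> L)} :=
  [pred D | `[< is_derivation D >]].

Fact derivation_submod_closed : submod_closed derivation_pred.
Proof.
split.
  rewrite inE; apply/asboolP; split=> [k u v|u v].
    by change (0 = k *: 0 + 0 :> L); rewrite scaler0 addr0.
  by change (0 = [br 0, v] + [br u, 0]); rewrite liebr0l liebr0r addr0.
move=> k f g; rewrite !inE => /asboolP[flin fbr] /asboolP[glin gbr].
apply/asboolP; split=> [l u v|u v].
  change (k *: f (l *: u + v) + g (l *: u + v) =
    l *: (k *: f u + g u) + (k *: f v + g v)).
  by rewrite flin glin !scalerDr !scalerA mulrC addrACA.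
change (k *: f [br u, v] + g [br u, v] =
  [br k *: f u + g u, v] + [br u, k *: f v + g v]).
by rewrite fbr gbr liebrDl liebrDr liebrZl liebrZr scalerDr addrACA.
Qed.

HB.instance Definition _ := GRing.isSubmodClosed.Build K (L -> L)
  derivation_pred derivation_submod_closed.

Record Der := MkDer {
  der_val :> L -> L;
  der_valP : der_val \in derivation_pred
}.

HB.instance Definition _ := [isSub for der_val].
HB.instance Definition _ := [Choice of Der by <:].
HB.instance Definition _ := [SubChoice_isSubLmodule of Der by <:].

Lemma derP (D : Der) : is_derivation D.
Proof. by have := der_valP D; rewrite inE => /asboolP. Qed.

Lemma derB (D : Der) (a b : L) : D (a - b) = D a - D b.
Proof.
have [Dlin _] := derP D.
by rewrite addrC -scaleN1r Dlin scaleN1r addrC.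
Qed.

Lemma derD (D : Der) (a b : L) : D (a + b) = D a + D b.
Proof. by have [Dlin _] := derP D; have := Dlin 1 a b; rewrite !scale1r. Qed.

Lemma derZ (D : Der) (k : K) (a : L) : D (k *: a) = k *: D a.
Proof.
have [Dlin _] := derP D; have D0 : D 0 = 0 by rewrite -[X in D X](subrr 0) derB subrr.
by rewrite -[k *: a]addr0 Dlin D0 addr0.
Qed.

Definition commutator (D1 D2 : L -> L) : L -> L :=
  fun a => D1 (D2 a) - D2 (D1 a).

Fact commutator_derivation (D1 D2 : Der) :
  commutator D1 D2 \in derivation_pred.
Proof.
have [_ br1] := derP D1; have [_ br2] := derP D2.
rewrite inE; apply/asboolP; split=> [k a b|a b]; rewrite /commutator.
  by rewrite !(derD, derZ) scalerBr opprD addrACA.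
rewrite br1 br2 !derD !br1 !br2 !liebrDl !liebrDr !liebrNl !liebrNr !opprD.
by rewrite !addrA (ACl (1*5*4*8*(2*7)*(3*6)))/= !subrr !addr0.
Qed.

Definition der_br (D1 D2 : Der) : Der := MkDer (commutator_derivation D1 D2).

Fact der_br_linearl (D2 : Der) : linear (der_br^~ D2).
Proof.
move=> k f g; apply/val_inj/funext => a.
change (k *: f (D2 a) + g (D2 a) - D2 (k *: f a + g a) =
  k *: (f (D2 a) - D2 (f a)) + (g (D2 a) - D2 (g a))).
by rewrite derD derZ scalerBr opprD addrACA.
Qed.

Fact der_brxx (D : Der) : der_br D D = 0.
Proof. by apply/val_inj/funext => a; apply: subrr. Qed.

Fact der_br_anti (D1 D2 : Der) : der_br D1 D2 = - der_br D2 D1.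
Proof.
apply/val_inj/funext => a.
by change (D1 (D2 a) - D2 (D1 a) = - (D2 (D1 a) - D1 (D2 a))); rewrite opprB.
Qed.

Fact der_br_linearr (D1 : Der) : linear (der_br D1).
Proof.
move=> k f g; rewrite der_br_anti der_br_linearl opprD -scalerN.
by rewrite -!der_br_anti.
Qed.

Fact der_br_jacobi (a b c : Der) :
  der_br a (der_br b c) + der_br b (der_br c a) + der_br c (der_br a b) = 0.
Proof.
apply/val_inj/funext => x.
change (a (b (c x) - c (b x)) - (b (c (a x)) - c (b (a x)))
  + (b (c (a x) - a (c x)) - (c (a (b x)) - a (c (b x))))
  + (c (a (b x) - b (a x)) - (a (b (c x)) - b (a (c x)))) = 0).
rewrite !derB !opprB !addrA.
by rewrite (ACl (1*12*(2*7)*(3*10)*(4*5)*(6*11)*(8*9)))/= !subrr !addNr !addr0.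
Qed.

HB.instance Definition _ := Lmodule_isLieAlgebra.Build K Der
  der_br_linearl der_br_linearr der_brxx der_br_jacobi.

End Derivations.

(* The Lie algebra presented by generators G and relations rel: Lie words     *)
(* modulo the smallest congruence containing rel and the Lie algebra axioms.  *)

Inductive lieword (K : Type) (G : Type) : Type :=
| WGen of G
| WZero
| WAdd of lieword K G & lieword K G
| WScale of K & lieword K G
| WBr of lieword K G & lieword K G.

Arguments WGen {K G}.
Arguments WZero {K G}.

HB.instance Definition _ (K G : Type) := gen_eqMixin (lieword K G).
HB.instance Definition _ (K G : Type) := gen_choiceMixin (lieword K G).

Section Presentation.
Variables (K : fieldType) (G : Type).
Local Notation word := (lieword K G).
Variable rel : word -> word -> Prop.

Inductive liecong : word -> word -> Prop :=
| liecong_rel s t : rel s t -> liecong s t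
| liecong_refl s : liecong s s
| liecong_sym s t : liecong s t -> liecong t s
| liecong_trans s t u : liecong s t -> liecong t u -> liecong s u
| liecong_add s s' t t' :
    liecong s s' -> liecong t t' -> liecong (WAdd s t) (WAdd s' t')
| liecong_scale k s s' : liecong s s' -> liecong (WScale k s) (WScale k s')
| liecong_br s s' t t' :
    liecong s s' -> liecong t t' -> liecong (WBr s t) (WBr s' t')
| liecong_addA s t u : liecong (WAdd s (WAdd t u)) (WAdd (WAdd s t) u)
| liecong_addC s t : liecong (WAdd s t) (WAdd t s)
| liecong_add0 s : liecong (WAdd WZero s) s
| liecong_addN s : liecong (WAdd (WScale (-1) s) s) WZero
| liecong_scaleA k l s : liecong (WScale k (WScale l s)) (WScale (k * l) s)
| liecong_scale1 s : liecong (WScale 1 s) s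
| liecong_scaleDr k s t :
    liecong (WScale k (WAdd s t)) (WAdd (WScale k s) (WScale k t))
| liecong_scaleDl k l s :
    liecong (WScale (k + l) s) (WAdd (WScale k s) (WScale l s))
| liecong_brl k s t u : liecong (WBr (WAdd (WScale k s) t) u)
                                (WAdd (WScale k (WBr s u)) (WBr t u))
| liecong_brr k s t u : liecong (WBr u (WAdd (WScale k s) t))
                                (WAdd (WScale k (WBr u s)) (WBr u t))
| liecong_brxx s : liecong (WBr s s) WZero
| liecong_jacobi s t u :
    liecong (WAdd (WAdd (WBr s (WBr t u)) (WBr t (WBr u s))) (WBr u (WBr s t)))
            WZero.

Definition liecongb (s t : word) := `[< liecong s t >].

Fact liecongb_refl : reflexive liecongb.
Proof. by move=> s; apply/asboolP/liecong_refl. Qed.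

Fact liecongb_sym : symmetric liecongb.
Proof. by move=> s t; apply/asboolP/asboolP; apply: liecong_sym. Qed.

Fact liecongb_trans : transitive liecongb.
Proof.
by move=> t s u /asboolP st /asboolP tu; apply/asboolP/(liecong_trans st tu).
Qed.

Canonical liecong_equiv := EquivRel liecongb
  liecongb_refl liecongb_sym liecongb_trans.

Definition presented := {eq_quot liecong_equiv}.

HB.instance Definition _ := EqQuotient.on presented.
HB.instance Definition _ := Choice.on presented.

Definition wclass (s : word) : presented := \pi_presented s.

Definition pgen (g : G) : presented := wclass (WGen g).

Lemma wclassP (s t : word) : wclass s = wclass t <-> liecong s t.
Proof.
split=> [/eqmodP/asboolP //|st].
by apply/eqmodP/asboolP.
Qed.

Lemma wclass_repr (p : presented) : wclass (repr p) = p.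
Proof. exact: reprK. Qed.

Lemma repr_wclass (s : word) : liecong (repr (wclass s)) s.
Proof. by apply/wclassP; rewrite wclass_repr. Qed.

Definition pzero : presented := wclass WZero.
Definition padd (p q : presented) := wclass (WAdd (repr p) (repr q)).
Definition pscale k (p : presented) := wclass (WScale k (repr p)).
Definition popp (p : presented) := pscale (-1) p.
Definition pbr (p q : presented) := wclass (WBr (repr p) (repr q)).

Lemma wclass_add s t : wclass (WAdd s t) = padd (wclass s) (wclass t).
Proof. by apply/wclassP/liecong_add; apply/liecong_sym/repr_wclass. Qed.

Lemma wclass_scale k s : wclass (WScale k s) = pscale k (wclass s).
Proof. by apply/wclassP/liecong_scale; apply/liecong_sym/repr_wclass. Qed.

Lemma wclass_br s t : wclass (WBr s t) = pbr (wclass s) (wclass t).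
Proof. by apply/wclassP/liecong_br; apply/liecong_sym/repr_wclass. Qed.

Let wclassE := (wclass_add, wclass_scale, wclass_br, wclass_repr).

Fact paddA : associative padd.
Proof.
move=> p q r; have /wclassP := liecong_addA (repr p) (repr q) (repr r).
by rewrite !wclassE.
Qed.

Fact paddC : commutative padd.
Proof. by move=> p q; apply/wclassP/liecong_addC. Qed.

Fact padd0 : left_id pzero padd.
Proof.
by move=> p; have /wclassP := liecong_add0 (repr p); rewrite !wclassE.
Qed.

Fact paddN : left_inverse pzero popp padd.
Proof.
by move=> p; have /wclassP := liecong_addN (repr p); rewrite !wclassE.
Qed.

HB.instance Definition _ :=
  GRing.isZmodule.Build presented paddA paddC padd0 paddN.

Fact pscaleA k l p : pscale k (pscale l p) = pscale (k * l) p.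
Proof.
by have /wclassP := liecong_scaleA k l (repr p); rewrite !wclassE.
Qed.

Fact pscale1 : left_id 1 pscale.
Proof.
by move=> p; have /wclassP := liecong_scale1 (repr p); rewrite !wclassE.
Qed.

Fact pscaleDr : right_distributive pscale +%R.
Proof.
move=> k p q; have /wclassP := liecong_scaleDr k (repr p) (repr q).
by rewrite !wclassE.
Qed.

Fact pscaleDl p : {morph pscale^~ p : k l / k + l}.
Proof.
by move=> k l; have /wclassP := liecong_scaleDl k l (repr p); rewrite !wclassE.
Qed.

HB.instance Definition _ := GRing.Zmodule_isLmodule.Build K presented
  pscaleA pscale1 pscaleDr pscaleDl.

Fact pbr_linearl q : linear (pbr^~ q).
Proof.
move=> k p r; have /wclassP := liecong_brl k (repr p) (repr r) (repr q).
by rewrite !wclassE.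
Qed.

Fact pbr_linearr q : linear (pbr q).
Proof.
move=> k p r; have /wclassP := liecong_brr k (repr p) (repr r) (repr q).
by rewrite !wclassE.
Qed.

Fact pbrxx p : pbr p p = 0.
Proof. by have /wclassP := liecong_brxx (repr p); rewrite !wclassE. Qed.

Fact pbr_jacobi p q r : pbr p (pbr q r) + pbr q (pbr r p) + pbr r (pbr p q) = 0.
Proof.
have /wclassP := liecong_jacobi (repr p) (repr q) (repr r).
by rewrite !wclassE.
Qed.

HB.instance Definition _ := Lmodule_isLieAlgebra.Build K presented
  pbr_linearl pbr_linearr pbrxx pbr_jacobi.

End Presentation.

(* The complexification of a real vector space E: the pair (u, v) stands for  *)
(* u (x) 1 + v (x) i.                                                         *)

Section Complexification.
Variables (R : rcfType) (E : lmodType R).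

Definition cplxn := (E * E)%type.

HB.instance Definition _ := GRing.Zmodule.on cplxn.

Definition cplxn_scale (z : R[i]) (w : cplxn) : cplxn :=
  let: a +i* b := z in (a *: w.1 - b *: w.2, a *: w.2 + b *: w.1).

Fact cplxn_scaleA z z' w :
  cplxn_scale z (cplxn_scale z' w) = cplxn_scale (z * z') w.
Proof.
case: z z' => [a b] [c d]; rewrite /cplxn_scale /=; congr pair.
  rewrite !scalerBr !scalerDr !scalerA !scalerBl !scalerDl !opprD.
  by rewrite !addrA [LHS](ACl (1*4*2*3)).
rewrite !scalerDr !scalerN !scalerA !scalerBl !scalerDl.
by rewrite !addrA [LHS](ACl (1*4*2*3)).
Qed.

Fact cplxn_scale1 : left_id 1 cplxn_scale.
Proof.
by case=> u v; rewrite /cplxn_scale /= !scale1r !scale0r subr0 addr0.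
Qed.

Fact cplxn_scaleDr : right_distributive cplxn_scale +%R.
Proof.
move=> [a b] [u v] [u' v']; rewrite /cplxn_scale /=; congr pair => /=.
  by rewrite !scalerDr opprD addrACA.
by rewrite !scalerDr addrACA.
Qed.

Fact cplxn_scaleDl w : {morph cplxn_scale^~ w : z z' / z + z'}.
Proof.
case: w => [u v] [a b] [c d]; rewrite /cplxn_scale /=; congr pair => /=.
  by rewrite !scalerDl opprD addrACA.
by rewrite !scalerDl addrACA.
Qed.

HB.instance Definition _ := GRing.Zmodule_isLmodule.Build R[i] cplxn
  cplxn_scaleA cplxn_scale1 cplxn_scaleDr cplxn_scaleDl.

Definition real_vec (u : E) : cplxn := (u, 0).

End Complexification.

Section RootSystems.
Variables (R : realType) (E : vectType R).
Local Notation Edual := 'Hom(E, R^o).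

Definition cpairing (alpha : Edual) (u : cplxn E) : R[i] :=
  alpha u.1 +i* alpha u.2.

Variable ip : {dot E for idfun}.

(* riesz alpha is the vector v such that alpha = ip v *)
Definition flat : 'Hom(E, Edual) :=
  linfun (fun v : E => linfun (ip v : E -> R^o) : Edual).

Definition riesz (alpha : Edual) : E := (flat^-1)%VF alpha.

Lemma flatE (v w : E) : flat v w = ip v w.
Proof.
have lin v' : linear (ip v' : E -> R^o).
  by move=> k a b; rewrite linearD linearZ.
have linE v' w' : (linfun (ip v' : E -> R^o) : Edual) w' = ip v' w'.
  pose f := GRing.isLinear.Build _ _ _ _ (ip v' : E -> R^o) (lin v').
  pose F : {linear E -> R^o} := HB.pack (ip v' : E -> R^o) f.
  exact: (lfunE F).
have lin2 : linear (fun v : E => linfun (ip v : E -> R^o) : Edual).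
  move=> k a b; apply/lfunP => c.
  by rewrite add_lfunE scale_lfunE !linE linearPl.
pose f := GRing.isLinear.Build _ _ _ _
  (fun v : E => linfun (ip v : E -> R^o) : Edual) lin2.
pose F : {linear E -> Edual} :=
  HB.pack (fun v : E => linfun (ip v : E -> R^o) : Edual) f.
by rewrite /flat (lfunE F) linE.
Qed.

Lemma rieszP (alpha : Edual) (v : E) : ip (riesz alpha) v = alpha v.
Proof.
have ker0 : lker flat == 0%VS.
  rewrite -subv0; apply/subvP => w; rewrite memv_ker memv0 => /eqP flat0.
  apply: contraT => w0; have := @neq0_dnorm_gt0 _ _ _ ip _ w0.
  by rewrite -flatE flat0 zero_lfunE ltxx.
have full : limg flat = fullv.
  apply/eqP; rewrite eqEdim subvf /=.
  have := limg_ker_dim flat fullv.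
  rewrite (eqP ker0) capv0 dimv0 add0n => ->.
  by rewrite !dimvf /dim /= muln1.
by rewrite -flatE /riesz limg_lfunVK // full memvf.
Qed.

Definition coroot (alpha : Edual) : E :=
  (2 / ip (riesz alpha) (riesz alpha)) *: riesz alpha.

Definition reflection (alpha beta : Edual) : Edual :=
  beta - beta (coroot alpha) *: alpha.

Record root_system (Phi : {fset Edual}) : Prop := RootSystem {
  root_neq0 : 0 \notin Phi;
  root_span : <<Phi>>%VS = fullv;
  root_refl : {in Phi &, forall alpha beta : Edual, reflection alpha beta \in Phi};
  root_crystallographic :
    {in Phi &, forall alpha beta : Edual,
      exists n : int, beta (coroot alpha) = n%:~R};
  root_reduced :
    {in Phi, forall (alpha : Edual) (c : R), c *: alpha \in Phi -> c = 1 \/ c = -1}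
}.

Variable Phi : {fset Edual}.

(* the roots that are positive on some Weyl chamber *)
Definition positive_system (P : {set Phi}) : Prop :=
  exists h : E, (forall alpha : Phi, val alpha h != 0) /\
    P = [set alpha : Phi | 0 < val alpha h].

Definition roots_of (Psi : {set Phi}) : seq Edual := [seq val b | b in Psi].

Definition root_subsystem (Psi : {set Phi}) : Prop :=
  forall alpha : Phi,
    inIntSpan (in_tuple (roots_of Psi)) (val alpha) <-> alpha \in Psi.

Definition root_rank (Psi : {set Phi}) : nat := \dim <<roots_of Psi>>%VS.

End RootSystems.

Section EllipticLieAlgebra.
Variables (R : realType) (E : vectType R) (Phi : {fset 'Hom(E, R^o)}).
Variable P : {set Phi}.
Local Notation h := (cplxn E).

Inductive ell_gen : Type := ell_t of Phi | ell_x of h | ell_y of h.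

Local Notation word := (lieword R[i] ell_gen).
Local Notation wt alpha := (WGen (ell_t alpha) : word).
Local Notation wx u := (WGen (ell_x u) : word).
Local Notation wy u := (WGen (ell_y u) : word).
Local Notation pair alpha u := (cpairing (val alpha) u).

(* ell_rel s t stands for the relation s = t *)
Inductive ell_rel : word -> word -> Prop :=
| ell_tN (alpha beta : Phi) :
    val beta = - val alpha -> ell_rel (wt beta) (wt alpha)
| ell_x_linear (k : R[i]) (u v : h) :
    ell_rel (wx (k *: u + v)) (WAdd (WScale k (wx u)) (wx v))
| ell_y_linear (k : R[i]) (u v : h) :
    ell_rel (wy (k *: u + v)) (WAdd (WScale k (wy u)) (wy v))
| ell_tt (Psi : {set Phi}) (alpha : Phi) :
    root_subsystem Psi -> root_rank Psi = 2%N -> alpha \in Psi ->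
    ell_rel (WBr (wt alpha) (\big[@WAdd _ _/WZero]_(beta in Psi :&: P) wt beta))
            WZero
| ell_xx (u v : h) : ell_rel (WBr (wx u) (wx v)) WZero
| ell_yy (u v : h) : ell_rel (WBr (wy u) (wy v)) WZero
| ell_yx (u v : h) :
    ell_rel (WBr (wy u) (wx v))
      (\big[@WAdd _ _/WZero]_(gamma in P)
          WScale (pair gamma v * pair gamma u) (wt gamma))
| ell_tx (alpha : Phi) (u : h) :
    pair alpha u = 0 -> ell_rel (WBr (wt alpha) (wx u)) WZero
| ell_ty (alpha : Phi) (u : h) :
    pair alpha u = 0 -> ell_rel (WBr (wt alpha) (wy u)) WZero.

Definition t_ell := presented ell_rel.

HB.instance Definition _ := LieAlgebra.on t_ell.

Definition t_ (alpha : Phi) : t_ell := pgen ell_rel (ell_t alpha).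
Definition x_ (u : h) : t_ell := pgen ell_rel (ell_x u).
Definition y_ (u : h) : t_ell := pgen ell_rel (ell_y u).

End EllipticLieAlgebra.

(* d_delta m stands for delta_{2m} *)

Inductive d_gen : Type :=
| d_Delta0
| d_d
| d_X
| d_delta (m : nat) of (0 < m)%N.

Section DLieAlgebra.
Variable R : realType.
Local Notation word := (lieword R[i] d_gen).
Local Notation Delta0 := (WGen d_Delta0 : word).
Local Notation d := (WGen d_d : word).
Local Notation X := (WGen d_X : word).
Local Notation delta m_gt0 := (WGen (d_delta m_gt0) : word).

Inductive d_rel : word -> word -> Prop :=
| d_rel_dX : d_rel (WBr d X) (WScale 2 X)
| d_rel_dDelta : d_rel (WBr d Delta0) (WScale (-2) Delta0)
| d_rel_XDelta : d_rel (WBr X Delta0) d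
| d_rel_deltaX (m : nat) (m_gt0 : (0 < m)%N) :
    d_rel (WBr (delta m_gt0) X) WZero
| d_rel_ddelta (m : nat) (m_gt0 : (0 < m)%N) :
    d_rel (WBr d (delta m_gt0)) (WScale (2 * m)%:R (delta m_gt0))
| d_rel_nilp (m : nat) (m_gt0 : (0 < m)%N) :
    d_rel (iter (2 * m).+1 (WBr Delta0) (delta m_gt0)) WZero.

Definition d_lie := presented d_rel.

HB.instance Definition _ := LieAlgebra.on d_lie.

Definition d_elt (xi : d_gen) : d_lie := pgen d_rel xi.

End DLieAlgebra.

Section TildeFormulas.
Variables (R : realType) (E : vectType R) (ip : {dot E for idfun}).
Variables (Phi : {fset 'Hom(E, R^o)}) (P : {set Phi}).
Local Notation h := (cplxn E).
Local Notation x := (x_ P).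
Local Notation y := (y_ P).
Local Notation t := (t_ P).

(* ad (x(alpha^vee) / 2) *)
Definition half_ad (alpha : Phi) (a : t_ell P) : t_ell P :=
  [br 2^-1 *: x (real_vec (coroot ip (val alpha))), a].

Definition tilde_delta_t (m : nat) (alpha : Phi) : t_ell P :=
  [br t alpha, iter (2 * m) (half_ad alpha) (t alpha)].

(* in the inner sum, q = 2m - 1 - p *)
Definition tilde_delta_y (m : nat) (u : h) : t_ell P :=
  2^-1 *: \sum_(alpha in P) cpairing (val alpha) u *:
    \sum_(p < 2 * m)
      [br iter p (half_ad alpha) (t alpha),
          iter ((2 * m).-1 - p) (fun a => - half_ad alpha a) (t alpha)].

Definition tilde_formulas (xi : d_gen) (D : t_ell P -> t_ell P) : Prop :=
  match xi with
  | d_d => [/\ forall u : h, D (x u) = x u, forall u : h, D (y u) = - y u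
             & forall alpha : Phi, D (t alpha) = 0]
  | d_X => [/\ forall u : h, D (x u) = 0, forall u : h, D (y u) = x u
             & forall alpha : Phi, D (t alpha) = 0]
  | d_Delta0 => [/\ forall u : h, D (x u) = y u, forall u : h, D (y u) = 0
                  & forall alpha : Phi, D (t alpha) = 0]
  | @d_delta m _ => [/\ forall u : h, D (x u) = 0,
                   forall alpha : Phi, D (t alpha) = tilde_delta_t m alpha
                   & forall u : h, D (y u) = tilde_delta_y m u]
  end.

End TildeFormulas.

(* Main.v *)
Require Import Defs.
From HB Require Import structures.
From mathcomp Require Import all_boot all_order all_algebra.
From mathcomp Require Import finmap sesquilinear boolp reals complex.
From mathcomp Require Import ring zify.

Set Implicit Arguments.
Unset Strict Implicit.
Unset Printing Implicit Defensive.

Import Order.TTheory GRing.Theory Num.Theory.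

Local Open Scope ring_scope.

(** An assignment on the generators of a presented Lie algebra extends to a
    derivation exactly when it satisfies the linearised relations
    ([derivation_presented]), so everything comes down to the relations of the
    elliptic Lie algebra. For d, X and Delta_0 they are immediate; the substance
    is delta_2m. Write k = 2m and t_a^(n) = (ad x(h))^n t_a, where a(h) = 1.

    The relations of the rank 2 subsystems are used in one form only: t_a
    commutes with the sum of t over each string b + Za of roots, b <> a, -a
    ([string_relation]). Applying ad x(u) with a(u) = 0, it also commutes with
    any combination of the t_c^(n) whose coefficients are constant along
    a-strings ([weighted_string_rel]). Hence [t_a, t_a^(k)] = [t_a, V] with
    V = 1/2 sum_c t_c^(k): on the t's, delta_2m is the inner derivation - ad V,
    and the rank 2 relations are preserved ([br_tau_total]).

    Two relations remain, both cubic in the t's: [t_a, y(u)] = 0 for a(u) = 0,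
    and [y(u), y(v)] = 0. Fix a root a and a vector w with a(w) = 0. Moving y(w)
    through the powers of ad x(h) expresses [y(w), t_a^(n)] by operators
    ((f + s_j g)^n - f^n) / g on the [t_a, t_j], with f = ad x(h), g = ad x(w)
    and the slope s_j chosen so that j(h + s_j w) = 0 ([y_tau]). The same
    element arises in a second way, as a sum over pairs (i, j) of roots coplanar
    with a of weighted divided differences of [t_i, t_j] ([plane_sum]): each
    term is a difference of a contribution of slope s_j and one of slope s_i
    ([divided_difference]), and because the weights depend on the lattice
    spanned by the roots only, each row is killed by the string relation at j,
    up to the two roots a and -a which the sum leaves out. The weight g^(k+2),
    where g generates the group spanned by the determinants of the pairs among
    a, i and j, is the choice that agrees with delta_2m on parallel roots.

    With w = u, adding the parallel pairs gives a multiple of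
    delta_2m(y(u)) - [y(u), t_a^(k)]; its coefficients are constant along
    a-strings in both variables, so it commutes with t_a, which is the first
    relation ([br_t_delta_y]). With w = a(v) u - a(u) v, bracketing with t_a^(c)
    and summing over a and c gives the image of [y(u), y(v)]; now the weights of
    triples of roots are invariant under rotation, and the Jacobi identity makes
    the sum vanish ([delta_y_comm]).

    The relations of the Lie algebra generated by Delta_0, d, X and the delta_2m
    hold for the derivations because they hold on generators; the nilpotency
    relation holds since Delta_0 trades each x for a y and then stops. *)

(** * Brackets *)

HB.instance Definition _ (K : fieldType) (L : lieAlgType K) (a : L) :=
  GRing.isLinear.Build K L L *:%R (liebr a) (liebr_linearr a).

Section Brackets.
Variables (K : fieldType) (L : lieAlgType K).
Implicit Types (a b c : L).

Lemma liebrC a b : [br a, b] = - [br b, a].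
Proof.
apply/eqP; rewrite -addr_eq0; apply/eqP.
by have := liebrxx (a + b); rewrite liebrDl !liebrDr !liebrxx addr0 add0r.
Qed.

Lemma liebr_leibniz a b c : [br a, [br b, c]] = [br [br a, b], c] + [br b, [br a, c]].
Proof.
have /eqP := liebr_jacobi a b c.
rewrite -addrA addr_eq0 => /eqP ->; rewrite opprD addrC.
by rewrite (liebrC c) opprK (liebrC c a) liebrNr opprK.
Qed.

Lemma liebr_suml I (r : seq I) (Q : pred I) (F : I -> L) b :
  [br \sum_(i <- r | Q i) F i, b] = \sum_(i <- r | Q i) [br F i, b].
Proof.
by rewrite liebrC raddf_sum -sumrN; apply: eq_bigr => i _; rewrite -liebrC.
Qed.

Lemma liebr_sumr I (r : seq I) (Q : pred I) (F : I -> L) b :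
  [br b, \sum_(i <- r | Q i) F i] = \sum_(i <- r | Q i) [br b, F i].
Proof. exact: raddf_sum. Qed.

Lemma iter_linear (V : lmodType K) (f : V -> V) n : linear f -> linear (iter n f).
Proof. by move=> lf; elim: n => [//|n IH] k u v /=; rewrite IH lf. Qed.

End Brackets.

Section IsLinear.
Variables (K : fieldType) (V W : lmodType K) (f : V -> W).
Hypothesis lf : linear f.

Lemma is_linear0 : f 0 = 0.
Proof. by have := lf (-1) 0 0; rewrite scaler0 addr0 scaleN1r addNr. Qed.
Lemma is_linearZ k u : f (k *: u) = k *: f u.
Proof. by rewrite -[k *: u]addr0 lf is_linear0 addr0. Qed.
Lemma is_linearD u v : f (u + v) = f u + f v.
Proof. by rewrite -[u]scale1r lf !scale1r. Qed.
Lemma is_linearN u : f (- u) = - f u.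
Proof. by rewrite -scaleN1r is_linearZ scaleN1r. Qed.
Lemma is_linearB u v : f (u - v) = f u - f v.
Proof. by rewrite is_linearD is_linearN. Qed.
Lemma is_linear_sum I (r : seq I) (Q : pred I) F :
  f (\sum_(i <- r | Q i) F i) = \sum_(i <- r | Q i) f (F i).
Proof. exact: (big_morph f is_linearD is_linear0). Qed.
End IsLinear.

(** * Derivations and morphisms out of a presented Lie algebra *)

Section Presented.
Variables (K : fieldType) (G : Type) (rel : lieword K G -> lieword K G -> Prop).
Local Notation L := (presented rel).
Local Notation cls := (wclass rel).
Local Notation word := (lieword K G).

Lemma cls_zero : cls WZero = 0. Proof. by []. Qed.
Lemma cls_add s t : cls (WAdd s t) = cls s + cls t.
Proof. exact: wclass_add. Qed.
Lemma cls_scale k s : cls (WScale k s) = k *: cls s.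
Proof. exact: wclass_scale. Qed.
Lemma cls_br s t : cls (WBr s t) = [br cls s, cls t].
Proof. exact: wclass_br. Qed.
Lemma cls_rel s t : rel s t -> cls s = cls t.
Proof. by move=> st; apply/wclassP; apply: liecong_rel. Qed.
Lemma cls_sum (I : Type) (r : seq I) (Q : pred I) (F : I -> word) :
  cls (\big[@WAdd _ _/WZero]_(i <- r | Q i) F i) = \sum_(i <- r | Q i) cls (F i).
Proof. exact: (big_morph cls cls_add cls_zero). Qed.

Lemma presented_ind (A : L -> Prop) :
  (forall g, A (pgen rel g)) -> A 0 ->
  (forall a b, A a -> A b -> A (a + b)) ->
  (forall k a, A a -> A (k *: a)) ->
  (forall a b, A a -> A b -> A [br a, b]) -> forall a, A a.
Proof.
move=> Ag A0 AD AZ AB a; rewrite -(wclass_repr a).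
elim: (repr a) => [g||s As t At|k s As|s As t At].
- exact: Ag.
- exact: A0.
- by rewrite cls_add; apply: AD.
- by rewrite cls_scale; apply: AZ.
- by rewrite cls_br; apply: AB.
Qed.

(** Evaluation of words in the square-zero extension L + eps L: this is the
    eps-component, whose compatibility with brackets is the Leibniz rule. *)
Fixpoint dword (g : G -> L) (s : word) : L :=
  match s with
  | WGen a => g a
  | WZero => 0
  | WAdd s t => dword g s + dword g t
  | WScale k s => k *: dword g s
  | WBr s t => [br dword g s, cls t] + [br cls s, dword g t]
  end.

Lemma dword_cong g s t : (forall s t, rel s t -> dword g s = dword g t) ->
  liecong rel s t -> dword g s = dword g t.
Proof.
move=> grel; elim=> //=.
- by move=> {}s {}t u _ -> _ ->.
- by move=> {}s s' {}t t' _ -> _ ->.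
- by move=> k {}s s' _ ->.
- by move=> {}s s' {}t t' /wclassP-> -> /wclassP-> ->.
- by move=> *; rewrite addrA.
- by move=> *; rewrite addrC.
- by move=> *; rewrite add0r.
- by move=> *; rewrite scaleN1r addNr.
- by move=> *; rewrite scalerA.
- by move=> *; rewrite scale1r.
- by move=> *; rewrite scalerDr.
- by move=> *; rewrite scalerDl.
- move=> k {}s {}t u; rewrite !cls_add !cls_scale !liebrDl !liebrZl.
  by rewrite scalerDr addrACA.
- move=> k {}s {}t u; rewrite !cls_add !cls_scale !liebrDr !liebrZr.
  by rewrite scalerDr addrACA.
- by move=> {}s; rewrite (liebrC (dword g s)) addNr.
move=> {}s {}t u; rewrite !cls_br !liebrDr.
have J a b c : [br a, [br b, c]] + [br b, [br c, a]] + [br c, [br a, b]] = 0 :> L.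
  exact: liebr_jacobi.
rewrite !addrA [LHS](ACl ((1*6*8)*(2*4*9)*(3*5*7)))/=.
by rewrite !J !addr0.
Qed.

Lemma derivation_presented (g : G -> L) :
  (forall s t, rel s t -> dword g s = dword g t) ->
  exists D : Der L, forall a, D (pgen rel a) = g a.
Proof.
move=> grel; pose f (p : L) := dword g (repr p).
have fE s : f (cls s) = dword g s by apply/(dword_cong grel)/repr_wclass.
have der : is_derivation f.
  split=> [k a b|a b]; rewrite -(wclass_repr a) -(wclass_repr b).
    by rewrite -cls_scale -cls_add !fE.
  by rewrite -cls_br !fE.
have fP : f \in @derivation_pred K L by rewrite inE; apply/asboolP.
by exists (MkDer fP) => a; apply: fE.
Qed.

Lemma derivation_presented_unique (D D' : Der L) :
  (forall a, D (pgen rel a) = D' (pgen rel a)) -> D = D'.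
Proof.
move=> e; apply/val_inj/funext => p; change (D p = D' p).
have [lD bD] := derP D; have [lD' bD'] := derP D'.
elim/presented_ind: p => //.
- by rewrite !is_linear0.
- by move=> a b ea eb; rewrite !derD ea eb.
- by move=> k a ea; rewrite !derZ ea.
- by move=> a b ea eb; rewrite bD bD' ea eb.
Qed.

Fixpoint evalword (M : lieAlgType K) (g : G -> M) (s : word) : M :=
  match s with
  | WGen a => g a
  | WZero => 0
  | WAdd s t => evalword g s + evalword g t
  | WScale k s => k *: evalword g s
  | WBr s t => [br evalword g s, evalword g t]
  end.

Lemma evalword_cong (M : lieAlgType K) (g : G -> M) s t :
  (forall s t, rel s t -> evalword g s = evalword g t) ->
  liecong rel s t -> evalword g s = evalword g t.
Proof.
move=> grel; elim=> //=.
- by move=> {}s {}t u _ -> _ ->.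
- by move=> {}s s' {}t t' _ -> _ ->.
- by move=> k {}s s' _ ->.
- by move=> {}s s' {}t t' _ -> _ ->.
- by move=> *; rewrite addrA.
- by move=> *; rewrite addrC.
- by move=> *; rewrite add0r.
- by move=> *; rewrite scaleN1r addNr.
- by move=> *; rewrite scalerA.
- by move=> *; rewrite scale1r.
- by move=> *; rewrite scalerDr.
- by move=> *; rewrite scalerDl.
- by move=> *; rewrite liebrDl liebrZl.
- by move=> *; rewrite liebrDr liebrZr.
- by move=> *; rewrite liebrxx.
- by move=> *; rewrite liebr_jacobi.
Qed.

Lemma morphism_presented (M : lieAlgType K) (g : G -> M) :
  (forall s t, rel s t -> evalword g s = evalword g t) ->
  exists f : L -> M, lie_morphism f /\ forall a, f (pgen rel a) = g a.
Proof.
move=> grel; pose f (p : L) := evalword g (repr p).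
have fE s : f (cls s) = evalword g s by apply/(evalword_cong grel)/repr_wclass.
exists f; split=> [|a]; last exact: fE.
split=> [k a b|a b]; rewrite -(wclass_repr a) -(wclass_repr b).
  by rewrite -cls_scale -cls_add !fE.
by rewrite -cls_br !fE.
Qed.

Lemma morphism_presented_unique (M : lieAlgType K) (f f' : L -> M) :
  lie_morphism f -> lie_morphism f' ->
  (forall a, f (pgen rel a) = f' (pgen rel a)) -> f = f'.
Proof.
move=> [lf bf] [lf' bf'] e; apply/funext => p.
elim/presented_ind: p => //.
- by rewrite !is_linear0.
- by move=> a b ea eb; rewrite !is_linearD // ea eb.
- by move=> k a ea; rewrite !is_linearZ // ea.
- by move=> a b ea eb; rewrite bf bf' ea eb.
Qed.

End Presented.

(** * Powers of a derivation *)

Section DerivationPowers.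
Variables (K : fieldType) (L : lieAlgType K).

Lemma der_br_leibniz (D : Der L) a b : D [br a, b] = [br D a, b] + [br a, D b].
Proof. by have [_] := derP D; apply. Qed.

Lemma der0 (D : Der L) : D 0 = 0.
Proof. exact: is_linear0 (derP D).1. Qed.

Lemma derN (D : Der L) a : D (- a) = - D a.
Proof. exact: is_linearN (derP D).1 _. Qed.

Lemma der_sum (D : Der L) I (r : seq I) (Q : pred I) (F : I -> L) :
  D (\sum_(i <- r | Q i) F i) = \sum_(i <- r | Q i) D (F i).
Proof. exact: is_linear_sum (derP D).1 _ _ _ _. Qed.

Lemma iter_der0 (D : Der L) n : iter n D 0 = 0.
Proof. exact: is_linear0 (iter_linear _ (derP D).1). Qed.

(** By the Leibniz rule every application of D falls on one of the two factors,
    and a + b + 1 of them exhaust one of the factors. *)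
Lemma iter_der_nilp (D : Der L) a b z z' :
  iter a.+1 D z = 0 -> iter b.+1 D z' = 0 -> iter (a + b).+1 D [br z, z'] = 0.
Proof.
have [n] := ubnP (a + b); elim: n => // n IH in a b z z' *.
rewrite ltnS => lab za zb; rewrite iterSr der_br_leibniz.
have lin := iter_linear (a + b) (derP D).1.
rewrite (is_linearD lin); move: za zb; rewrite !iterSr => za zb.
have -> : iter (a + b) D [br D z, z'] = 0.
  case: a za lab {lin} => [|a] za lab.
    by move: za => /= ->; rewrite liebr0l iter_der0.
  by rewrite addSn; apply: IH => //; rewrite iterSr.
rewrite add0r; case: b zb lab {lin} => [|b] zb lab.
  by move: zb => /= ->; rewrite liebr0r iter_der0.
by rewrite addnS; apply: IH => //; [rewrite addnS in lab | rewrite iterSr].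
Qed.

End DerivationPowers.

(** * Divided differences of commuting operators *)

Section DividedDifferences.
Variables (K : fieldType) (V : lmodType K) (f g : V -> V).
Hypotheses (lf : linear f) (lg : linear g) (fg : forall v, f (g v) = g (f v)).
Implicit Types (s : K) (v : V).

Definition pencil s v := f v + s *: g v.

(** potential n s is ((f + s g)^(n+1) - f^(n+1)) / g, without the division:
    see potential_div. *)
Fixpoint potential n s v : V :=
  if n is m.+1 then f (potential m s v) + s *: iter n (pencil s) v else s *: v.

Let pencil_linear s : linear (pencil s).
Proof.
by move=> k u v; rewrite /pencil lf lg !scalerDr !scalerA mulrC addrACA.
Qed.

Lemma potential_div n s v :
  g (potential n s v) = iter n.+1 (pencil s) v - iter n.+1 f v.
Proof.
elim: n => [|n IH].
  by rewrite /= (is_linearZ lg) /pencil addrAC subrr add0r.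
have gE u : s *: g u = pencil s u - f u by rewrite /pencil addrAC subrr add0r.
rewrite [potential _ _ _]/= (is_linearD lg) (is_linearZ lg) -fg IH gE.
by rewrite (is_linearB lf) addrC addrA subrK.
Qed.

(** The point is that the right-hand side separates s from s': a divided
    difference attached to two root lines becomes a difference of two terms that
    see one line each. *)
Lemma divided_difference n s s' v :
  (s - s') *: (\sum_(p < n.+1) iter p (pencil s) (iter (n - p) (pencil s') v)) =
  potential n s v - potential n s' v.
Proof.
elim: n => [|n IH].
  by rewrite big_ord1 /= scalerBl.
rewrite big_ord_recl subn0 /=.
under eq_bigr => p _ do rewrite /bump add1n subSS.
rewrite -(is_linear_sum (pencil_linear s)) scalerDr.
rewrite -(is_linearZ (pencil_linear s)) IH (is_linearB (pencil_linear s)).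
have pE r : pencil s (potential n r v) =
    f (potential n r v) + s *: (iter n.+1 (pencil r) v - iter n.+1 f v).
  by rewrite -potential_div.
rewrite !pE -!iterS !scalerBr !scalerBl.
move: (f (potential n s v)) (f (potential n s' v)) => a b.
move: (s *: iter _ _ _) (s *: iter _ _ _) (s *: iter _ _ _) (s' *: _) => x y z w.
rewrite !opprD !addrA ?opprK.
by rewrite [LHS](ACl (3*4*6*2*(1*7)*(5*8)))/= subrr addNr !addr0.
Qed.

End DividedDifferences.

(** * Weights attached to cyclic groups of numbers *)

Section GroupWeight.
Variables (C : numFieldType).
Implicit Types (x y z d : C).

Definition zspan3 x y z : C -> Prop :=
  fun w => exists a b c : int, w = x *~ a + y *~ b + z *~ c.

Lemma zspan3_sub x y z x' y' z' :
  zspan3 x' y' z' x -> zspan3 x' y' z' y -> zspan3 x' y' z' z ->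
  forall w, zspan3 x y z w -> zspan3 x' y' z' w.
Proof.
move=> [a1 [b1 [c1 ->]]] [a2 [b2 [c2 ->]]] [a3 [b3 [c3 ->]]] w [a [b [c ->]]].
exists (a1 * a + a2 * b + a3 * c), (b1 * a + b2 * b + b3 * c), (c1 * a + c2 * b + c3 * c).
rewrite !mulrzDr !mulrzDl -?mulrzA !mulrzA.
by rewrite !addrA [LHS](ACl (1*4*7*2*5*8*3*6*9)).
Qed.

Lemma zspan3_eq x y z x' y' z' :
  zspan3 x' y' z' x -> zspan3 x' y' z' y -> zspan3 x' y' z' z ->
  zspan3 x y z x' -> zspan3 x y z y' -> zspan3 x y z z' ->
  zspan3 x y z = zspan3 x' y' z'.
Proof.
move=> *; apply/funext => w; apply/propext; split; exact: zspan3_sub.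
Qed.

(** A generator of a cyclic group of numbers, 0 for a group that is not cyclic.
    It is chosen as a function of the group, so that the weights below are
    invariant under every change of generators. *)
Definition zgen (S : C -> Prop) : C :=
  if pselect (exists g, S = zspan3 g 0 0) is left H then sval (cid H) else 0.

Definition gweight k x y z : C := zgen (zspan3 x y z) ^+ k.

Lemma gweight_rot k x y z : gweight k x y z = gweight k y z x.
Proof.
rewrite /gweight; congr (zgen _ ^+ _); apply: zspan3_eq.
- by exists 0, 0, 1; rewrite mulr1z !mulr0z !add0r.
- by exists 1, 0, 0; rewrite mulr1z !mulr0z !addr0.
- by exists 0, 1, 0; rewrite mulr1z !mulr0z addr0 add0r.
- by exists 0, 1, 0; rewrite mulr1z !mulr0z addr0 add0r.
- by exists 0, 0, 1; rewrite mulr1z !mulr0z !add0r.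
- by exists 1, 0, 0; rewrite mulr1z !mulr0z !addr0.
Qed.

Lemma gweight_swap k x y z : gweight k x y z = gweight k x z y.
Proof.
rewrite /gweight; congr (zgen _ ^+ _); apply: zspan3_eq.
- by exists 1, 0, 0; rewrite mulr1z !mulr0z !addr0.
- by exists 0, 0, 1; rewrite mulr1z !mulr0z !add0r.
- by exists 0, 1, 0; rewrite mulr1z !mulr0z addr0 add0r.
- by exists 1, 0, 0; rewrite mulr1z !mulr0z !addr0.
- by exists 0, 0, 1; rewrite mulr1z !mulr0z !add0r.
- by exists 0, 1, 0; rewrite mulr1z !mulr0z addr0 add0r.
Qed.

Lemma gweightN k x y z : gweight k (- x) y z = gweight k x y z.
Proof.
rewrite /gweight; congr (zgen _ ^+ _); apply: zspan3_eq.
- by exists (-1), 0, 0; rewrite mulrNz mulr1z !mulr0z !addr0.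
- by exists 0, 1, 0; rewrite mulr1z !mulr0z addr0 add0r.
- by exists 0, 0, 1; rewrite mulr1z !mulr0z !add0r.
- by exists (-1), 0, 0; rewrite mulrNz mulr1z opprK !mulr0z !addr0.
- by exists 0, 1, 0; rewrite mulr1z !mulr0z addr0 add0r.
- by exists 0, 0, 1; rewrite mulr1z !mulr0z !add0r.
Qed.

Lemma gweight_shear k x y z n : gweight k (x + y *~ n) y z = gweight k x y z.
Proof.
rewrite /gweight; congr (zgen _ ^+ _); apply: zspan3_eq.
- by exists 1, n, 0; rewrite mulr1z mulr0z addr0.
- by exists 0, 1, 0; rewrite mulr1z !mulr0z addr0 add0r.
- by exists 0, 0, 1; rewrite mulr1z !mulr0z !add0r.
- by exists 1, (- n), 0; rewrite mulr1z mulr0z addr0 mulrNz addrK.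
- by exists 0, 1, 0; rewrite mulr1z !mulr0z addr0 add0r.
- by exists 0, 0, 1; rewrite mulr1z !mulr0z !add0r.
Qed.

(** The generator is determined up to sign, which an even power forgets. *)
Lemma gweight_cyclic k d : ~~ odd k -> gweight k d 0 0 = d ^+ k.
Proof.
move=> ek; rewrite /gweight /zgen; case: pselect => [H|[]]; last by exists d.
case: cid => g /= e.
have [a ga] : exists a, g = d *~ a.
  have : zspan3 g 0 0 g by exists 1, 0, 0; rewrite mul0rz !addr0.
  by rewrite -e => -[a [b [c ->]]]; exists a; rewrite !mul0rz !addr0.
have [b db] : exists b, d = g *~ b.
  have : zspan3 d 0 0 d by exists 1, 0, 0; rewrite mul0rz !addr0.
  by rewrite e => -[b [c [c' ->]]]; exists b; rewrite !mul0rz !addr0.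
have [d0|d0] := eqVneq d 0; first by rewrite ga d0 mul0rz.
have ab : a * b = 1.
  move: db; rewrite ga -mulrzA => /eqP; rewrite -{1}[d]mulr1z.
  by rewrite eq_sym -subr_eq0 -mulrzBr mulrz_eq0 (negPf d0) orbF subr_eq0 => /eqP.
have : a = 1 \/ a = -1.
  have /eqP := congr1 absz ab.
  by rewrite abszM muln_eq1 => /andP[/eqP a1 _]; lia.
rewrite ga; case=> ->; first by rewrite mulr1z.
by rewrite mulrNz mulr1z exprNn -signr_odd (negPf ek) expr0 mul1r.
Qed.

Lemma gweight_dup k d : ~~ odd k -> gweight k d d 0 = d ^+ k.
Proof.
move=> ek; have := gweight_shear k 0 d 0 1; rewrite add0r mulr1z => ->.
by rewrite gweight_rot gweight_cyclic.
Qed.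

End GroupWeight.

(** * Roots *)

Section Pairing.
Variables (R : realType) (E : vectType R).
Implicit Types (alpha beta : 'Hom(E, R^o)) (u v : cplxn E).

Lemma cpairing_linear alpha : linear (cpairing alpha : cplxn E -> R[i]^o).
Proof.
case=> [a b] [u1 u2] [v1 v2]; rewrite /cpairing /=.
rewrite !linearD !linearN !linearZ /=; apply/eqP; rewrite eq_complex /=.
by apply/andP; split; apply/eqP; rewrite /GRing.scale /=; ring.
Qed.

Lemma cpairingDl alpha beta u :
  cpairing (alpha + beta) u = cpairing alpha u + cpairing beta u.
Proof.
by apply/eqP; rewrite eq_complex /= !add_lfunE !eqxx.
Qed.

Lemma cpairingZl (a : R) alpha u : cpairing (a *: alpha) u = (a%:C)%C * cpairing alpha u.
Proof.
apply/eqP; rewrite eq_complex /= !scale_lfunE /GRing.scale /=.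
by rewrite !mul0r subr0 addr0 !eqxx.
Qed.

Lemma cpairingNl alpha u : cpairing (- alpha) u = - cpairing alpha u.
Proof. by rewrite -scaleN1r cpairingZl rmorphN1 mulN1r. Qed.

Lemma cpairing0l u : cpairing (0 : 'Hom(E, R^o)) u = 0.
Proof. by rewrite -(scale0r 0) cpairingZl rmorph0 mul0r. Qed.

Lemma cpairingMzl alpha n u : cpairing (alpha *~ n) u = cpairing alpha u *~ n.
Proof.
have M m : cpairing (alpha *+ m) u = cpairing alpha u *+ m.
  by elim: m => [|m IH]; rewrite ?cpairing0l // !mulrS cpairingDl IH.
by case: n => m; rewrite ?NegzE ?mulrNz ?cpairingNl -!pmulrn M.
Qed.

Lemma cpairing_real alpha (u : E) : cpairing alpha (real_vec u) = ((alpha u)%:C)%C.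
Proof. by rewrite /cpairing /real_vec /= linear0. Qed.

End Pairing.

Section Roots.
Variables (R : realType) (E : vectType R) (ip : {dot E for idfun}).
Variables (Phi : {fset 'Hom(E, R^o)}) (Phi_root : root_system ip Phi).
Local Notation C := (R[i]).
Implicit Types (i j l : Phi) (u v w : cplxn E).

Definition pr i u : C := cpairing (val i) u.

Lemma pr_linear i : linear (pr i : cplxn E -> C^o).
Proof. exact: cpairing_linear. Qed.
Lemma prD i u v : pr i (u + v) = pr i u + pr i v.
Proof. exact: (is_linearD (pr_linear i)). Qed.
Lemma prB i u v : pr i (u - v) = pr i u - pr i v.
Proof. exact: (is_linearB (pr_linear i)). Qed.
Lemma prZ i k u : pr i (k *: u) = k * pr i u.
Proof. exact: (is_linearZ (pr_linear i)). Qed.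

Lemma root_nz i : val i != 0.
Proof.
by apply: contraNneq (root_neq0 Phi_root) => <-; apply: valP.
Qed.

Lemma root_coroot i : (val i : 'Hom(E, R^o)) (coroot ip (val i)) = 2.
Proof.
rewrite /coroot linearZ /= -{3}[val i]/(val i) -(rieszP ip (val i)).
have r0 : riesz ip (val i) != 0.
  apply: contraNneq (root_nz i) => r0; apply/eqP/lfunP => v.
  by rewrite -(rieszP ip) r0 zero_lfunE linear0l.
have := @neq0_dnorm_gt0 _ _ _ ip _ r0 => /lt0r_neq0 n0.
by rewrite /GRing.scale /= mulrVK ?unitfE.
Qed.

Lemma opposite_root i : {j : Phi | val j = - val i}.
Proof.
have := root_refl Phi_root (valP i) (valP i); rewrite /reflection root_coroot.
rewrite scaler_nat mulr2n opprD addrA subrr add0r => iPhi.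
by exists [` iPhi]%fset.
Qed.

Definition ropp i : Phi := sval (opposite_root i).

Lemma val_ropp i : val (ropp i) = - val i.
Proof. exact: (svalP (opposite_root i)). Qed.

Lemma roppK : involutive ropp.
Proof. by move=> i; apply/val_inj; rewrite !val_ropp opprK. Qed.

Lemma pr_ropp i u : pr (ropp i) u = - pr i u.
Proof. by rewrite /pr val_ropp cpairingNl. Qed.

Lemma ropp_neq i : ropp i != i.
Proof.
apply/negP => /eqP /(congr1 val); rewrite val_ropp => /eqP.
rewrite eq_sym -subr_eq0 opprK -mulr2n -scaler_nat scaler_eq0 pnatr_eq0 /=.
by rewrite (negPf (root_nz i)).
Qed.

(** Distinct root lines are linearly independent: this is reducedness. *)
Lemma root_prop i j (a b : R) :
  (a, b) != 0 -> a *: val i + b *: val j = 0 -> j = i \/ j = ropp i.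
Proof.
move=> ab0 e.
have b0 : b != 0.
  apply: contraNneq ab0 => b0; move: e; rewrite b0 scale0r addr0 => /eqP.
  by rewrite scaler_eq0 (negPf (root_nz i)) orbF => /eqP ->.
have ej : val j = (- a / b) *: val i.
  apply: (scalerI b0); rewrite scalerA mulrCA divff // mulr1 scaleNr.
  by apply/eqP; rewrite -addr_eq0 addrC e.
have [] := root_reduced Phi_root (valP i) (c := - a / b).
- by rewrite -ej; apply: valP.
- by move=> c1; left; apply/val_inj; rewrite ej c1 scale1r.
- by move=> c1; right; apply/val_inj; rewrite val_ropp ej c1 scaleN1r.
Qed.

(** If j vanished on the kernel of i, it would be proportional to i. *)
Lemma dual_vector i j : j != i -> j != ropp i ->
  exists u, pr i u = 0 /\ pr j u = 1.
Proof.
move=> ji jni.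
have [[z [iz jz]]|H] := pselect (exists z : E, (val i : 'Hom(E, R^o)) z = 0 /\
    (val j : 'Hom(E, R^o)) z != 0).
  exists (real_vec (((val j : 'Hom(E, R^o)) z)^-1 *: z)).
  rewrite /pr !cpairing_real !linearZ /= iz /GRing.scale /= mulr0; split=> //.
  by rewrite mulVf.
have [h i0] : exists h, (val i : 'Hom(E, R^o)) h = 2.
  by exists (coroot ip (val i)); apply: root_coroot.
have [] := @root_prop i j ((val j : 'Hom(E, R^o)) h) (-2).
- by rewrite xpair_eqE oppr_eq0 pnatr_eq0 andbF.
- apply/lfunP => z; rewrite add_lfunE !scale_lfunE zero_lfunE.
  have : (val j : 'Hom(E, R^o)) ((val i : 'Hom(E, R^o)) z *: h - 2 *: z) = 0.
    apply: contrapT => /eqP nz; apply: H.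
    exists ((val i : 'Hom(E, R^o)) z *: h - 2 *: z); split=> //.
    rewrite linearB !linearZ /= i0 /GRing.scale /=; ring.
  rewrite linearB !linearZ /= /GRing.scale /= => e.
  by rewrite mulNr -[RHS]e; ring.
- by move=> e; rewrite e eqxx in ji.
- by move=> e; rewrite e eqxx in jni.
Qed.

Definition hvec i : cplxn E := 2^-1 *: real_vec (coroot ip (val i)).

Lemma pr_hvec i : pr i (hvec i) = 1.
Proof.
rewrite /hvec prZ /pr cpairing_real root_coroot.
by rewrite rmorph_nat mulVf // pnatr_eq0.
Qed.

End Roots.

(** * Root strings *)

Section Strings.
Variables (R : realType) (E : vectType R) (ip : {dot E for idfun}).
Variables (Phi : {fset 'Hom(E, R^o)}) (Phi_root : root_system ip Phi).
Local Notation C := (R[i]).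
Local Notation ropp := (ropp Phi_root).
Implicit Types (i j l : Phi).

Definition same_string (a i j : Phi) : bool :=
  `[< exists n : int, val j = val i + val a *~ n >].

Lemma same_string_refl a : reflexive (same_string a).
Proof. by move=> i; apply/asboolP; exists 0; rewrite mulr0z addr0. Qed.

Lemma same_string_sym a : symmetric (same_string a).
Proof.
by move=> i j; apply/asboolP/asboolP => -[n e]; exists (- n);
  rewrite e mulrNz addrK.
Qed.

Lemma same_string_trans a : transitive (same_string a).
Proof.
move=> j i l /asboolP[n e] /asboolP[n' e']; apply/asboolP; exists (n + n').
by rewrite e' e mulrzDr addrA.
Qed.

Lemma root_mul i j (a : int) : val j = val i *~ a -> j = i \/ j = ropp i.
Proof.
move=> e; apply: (root_prop Phi_root (a := a%:~R) (b := -1)).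
  by rewrite xpair_eqE oppr_eq0 oner_eq0 andbF.
by rewrite scaler_int e scaleN1r subrr.
Qed.

Definition lattice_roots (a b : Phi) (m : nat) : {set Phi} :=
  [set j : Phi | `[< exists p q : int, val j = val a *~ p + val b *~ (q *~ m) >]].

Lemma lattice_rootsP a b (m : nat) j :
  reflect (exists p q : int, val j = val a *~ p + val b *~ (q *~ m))
    (j \in lattice_roots a b m).
Proof. by rewrite inE; apply: asboolP. Qed.

Lemma mem_lattice_roots a b m : a \in lattice_roots a b m.
Proof. by apply/lattice_rootsP; exists 1, 0; rewrite mul0rz mulr0z addr0. Qed.

Lemma root_subsystem_lattice a b m : root_subsystem (lattice_roots a b m).
Proof.
set Psi := lattice_roots a b m => j; split; last first.
  move=> jPsi; have js : val j \in roots_of Psi by apply: image_f.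
  have ks : (index (val j) (roots_of Psi) < size (roots_of Psi))%N by rewrite index_mem.
  exists [ffun l => (l == Ordinal ks)%:Z].
  rewrite (bigD1 (Ordinal ks)) //= big1 ?addr0.
    by rewrite ffunE eqxx mulr1z nth_index.
  by move=> l /negPf nl; rewrite ffunE nl mulr0z.
move=> [c ej]; apply/lattice_rootsP.
pose lat (v : 'Hom(E, R^o)) :=
  exists p q : int, v = val a *~ p + val b *~ (q *~ m).
suff: lat (val j) by [].
rewrite ej; apply: big_ind.
- by exists 0, 0; rewrite mul0rz !mulr0z addr0.
- move=> _ _ [p [q ->]] [p' [q' ->]]; exists (p + p'), (q + q').
  by rewrite mulrzDl !mulrzDr addrACA.
move=> l _; have : (in_tuple (roots_of Psi))`_l \in roots_of Psi by rewrite mem_nth.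
move=> /imageP[i /lattice_rootsP[p [q e]] ->]; exists (p * c l), (q * c l).
by rewrite e mulrzDl -!mulrzA !mulrzz mulrAC.
Qed.

Lemma root_rank_lattice a b m i : b != a -> b != ropp a ->
  i \in lattice_roots a b m -> i != a -> i != ropp a ->
  root_rank (lattice_roots a b m) = 2.
Proof.
set Psi := lattice_roots a b m => ba bna iPsi ia ina.
have free2 l : l != a -> l != ropp a -> free [:: val a; val l].
  move=> la lna; apply/freeP => k; rewrite !big_ord_recl big_ord0 addr0 /= => e.
  have k0 : (k ord0, k (lift ord0 ord0)) == 0.
    apply: contraT => knz; have [el|el] := root_prop Phi_root knz e.
      by rewrite el eqxx in la.
    by rewrite el eqxx in lna.
  case/eqP: k0 => k0 k1; case=> [[|[|n]]] // lt; first by rewrite -k0; congr k; apply/val_inj.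
  by rewrite -k1; congr k; apply/val_inj.
have dim2 l : l != a -> l != ropp a -> \dim <<[:: val a; val l]>> = 2.
  by move=> la lna; apply/eqP; apply: (free2 _ la lna).
apply/eqP; rewrite /root_rank eqn_leq; apply/andP; split.
  rewrite -(dim2 b ba bna); apply/dimvS/span_subvP => _ /imageP[l /lattice_rootsP[p [q e]] ->].
  rewrite e; apply: rpredD; apply: rpredMz; apply: memv_span; rewrite !inE eqxx //.
  by rewrite orbT.
rewrite -(dim2 i ia ina); apply/dimvS/sub_span => v; rewrite !inE => /orP[]/eqP->.
  by apply: image_f; apply: mem_lattice_roots.
exact: image_f.
Qed.

Variables (L : lieAlgType C) (t : Phi -> L).
Hypothesis t_ropp : forall i, t (ropp i) = t i.
Hypothesis t_subsystem : forall (Psi : {set Phi}) i,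
  root_subsystem Psi -> root_rank Psi = 2 -> i \in Psi ->
  \sum_(j in Psi) [br t i, t j] = 0.

(** The b-coordinate up to sign, which is what the divisibility conditions
    defining the lattices Za + mZb test. *)
Lemma lattice_coordinate a b : b != a -> b != ropp a ->
  exists c : Phi -> nat, forall i (p q : int), val i = val a *~ p + val b *~ q ->
    c i = `|q|%N.
Proof.
move=> ba bna; have [v [av bv]] := dual_vector ba bna.
suff /choice[c cP] : forall i, exists n, forall p q : int,
  val i = val a *~ p + val b *~ q -> n = `|q|%N by exists c.
move=> i.
have [[q [p e]]|H] := pselect (exists q p : int, val i = val a *~ p + val b *~ q).
  exists `|q|%N => p' q'; rewrite e => /(congr1 (fun z : 'Hom(E, R^o) => cpairing z v)).
  rewrite !cpairingDl !cpairingMzl -!/(pr _ _) av bv !mul0rz !add0r.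
  by move=> /eqP; rewrite eqr_int => /eqP ->.
by exists 0%N => p q e; case: H; exists q, p.
Qed.

(** The relation of the subsystem of Za + mZb says that t_a commutes with the
    sum of t over the roots whose b-coordinate is divisible by m. Moebius
    inversion over m, in the form of a descending induction, isolates the roots
    of b-coordinate 1 or -1: the string through b and its opposite. *)
Lemma string_relation a b : b != a -> b != ropp a ->
  \sum_(j | same_string a b j) [br t a, t j] = 0.
Proof.
move=> ba bna; have [c cP] := lattice_coordinate ba bna.
pose Psi1 := lattice_roots a b 1.
have Psi1P i (m : nat) : (i \in lattice_roots a b m) = (i \in Psi1) && (m %| c i)%N.
  apply/lattice_rootsP/andP => [[p [q e]]|[/lattice_rootsP[p [q e]] mc]].
    split; first by apply/lattice_rootsP; exists p, (q *~ m); rewrite mulr1z.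
    by rewrite (cP _ _ _ e) mulrzz abszM dvdn_mull.
  rewrite mulr1z in e; rewrite (cP _ _ _ e) in mc.
  have /dvdzP[q' eq'] : (m %| q)%Z by [].
  by exists p, q'; rewrite mulrzz -eq'.
have ta0 i : i = a \/ i = ropp a -> [br t a, t i] = 0.
  by case=> ->; rewrite ?t_ropp liebrxx.
have c0 i : i \in Psi1 -> c i = 0%N -> [br t a, t i] = 0.
  move=> /lattice_rootsP[p [q e]]; rewrite mulr1z in e; rewrite (cP _ _ _ e) => /eqP.
  rewrite absz_eq0 => /eqP q0; apply: ta0; apply: (@root_mul _ _ p).
  by rewrite e q0 mulr0z addr0.
have A m : \sum_(i in Psi1 | (m %| c i)%N) [br t a, t i] = 0.
  under eq_bigl => i do rewrite -Psi1P.
  have [[i [iP ia ina]]|H] :=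
      pselect (exists i, [/\ i \in lattice_roots a b m, i != a & i != ropp a]).
    apply: t_subsystem; [exact: root_subsystem_lattice| exact: root_rank_lattice iP ia ina|].
    exact: mem_lattice_roots.
  apply: big1 => i iP; apply: ta0; apply: contrapT => /not_orP[/eqP ia /eqP ina].
  exact: (H (ex_intro _ i (And3 iP ia ina))).
(* n measures the distance of m from the largest coordinate *)
have F n m : (0 < m)%N -> (\max_i c i < m + n)%N ->
    \sum_(i in Psi1 | c i == m) [br t a, t i] = 0.
  elim: n m => [|n IH] m m0 ltm.
    apply: big_pred0 => i; apply/negbTE/negP => /andP[_ /eqP cm].
    by have := leq_bigmax (F := c) i; rewrite cm leqNgt -[m]addn0 ltm.
  have := A m; rewrite (bigID (fun i => c i == m)) /=.
  rewrite [X in _ + X = _ -> _](partition_big (fun i => inord (c i) : 'I_(\max_i c i).+1) xpredT) //=.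
  rewrite [X in _ + X = _ -> _]big1 ?addr0 => [|l _].
    move=> e; rewrite -[RHS]e; apply: eq_bigl => i; rewrite -andbA; congr andb.
    by apply/idP/andP => [/eqP ->|[]//]; rewrite dvdnn eqxx.
  have inordE i : (inord (c i) == l :> 'I_(\max_i c i).+1) = (c i == l :> nat).
    by rewrite -val_eqE /= inordK // ltnS; apply: leq_bigmax.
  have [l0|l0] := posnP l.
    by apply: big1 => i; rewrite inordE l0 => /andP[/andP[/andP[iP _] _] /eqP]; apply: c0.
  have [ml|ml] := ltnP m l.
    have [dl|dl] := boolP (m %| l)%N; last first.
      apply: big_pred0 => i; rewrite inordE; apply/negbTE/negP.
      by move=> /andP[/andP[/andP[_ mc] _] /eqP cl]; rewrite -cl mc in dl.
    rewrite -[RHS](IH l l0); last by apply: leq_trans ltm _; rewrite addnS ltn_add2r.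
    apply: eq_bigl => i; rewrite inordE -!andbA; congr andb.
    apply/idP/idP => [/and3P[]//|/eqP cl]; rewrite cl dl eqxx andbT /=.
    by rewrite neq_ltn ml orbT.
  apply: big_pred0 => i; rewrite inordE; apply/negbTE/negP.
  move=> /andP[/andP[/andP[_ mc] cm] /eqP cl]; rewrite cl in mc cm.
  by have := dvdn_leq l0 mc; rewrite leq_eqVlt eq_sym (negPf cm) ltnNge ml.
have := F (\max_i c i) 1%N isT; rewrite add1n => /(_ (leqnn _)).
have b1 (i : Phi) : ((i \in Psi1) && (c i == 1%N)) = same_string a b i || same_string a b (ropp i).
  apply/andP/orP => [[/lattice_rootsP[p [q e]]]|].
    rewrite mulr1z in e; rewrite (cP _ _ _ e) => /eqP q1.
    have [q1'|q1'] : q = 1 \/ q = -1 by lia.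
      by left; apply/asboolP; exists p; rewrite e q1' mulr1z addrC.
    right; apply/asboolP; exists (- p).
    by rewrite val_ropp e q1' opprD mulrNz mulrNz mulr1z opprK addrC.
  case=> /asboolP[p e].
    have e' : val i = val a *~ p + val b *~ 1 by rewrite e addrC mulr1z.
    by split; [apply/lattice_rootsP; exists p, 1; rewrite mulr1z | rewrite (cP _ _ _ e')].
  have e' : val i = val a *~ (- p) + val b *~ (- 1).
    by rewrite !mulrNz mulr1z -opprD addrC -e val_ropp opprK.
  by split; [apply/lattice_rootsP; exists (- p), (- 1); rewrite mulr1z | rewrite (cP _ _ _ e')].
under eq_bigl => i do rewrite b1.
have disj i : same_string a b i -> same_string a b (ropp i) = false.
  move=> /asboolP[p e]; apply/negbTE/negP => /asboolP[p' e'].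
  have [v [av bv]] := dual_vector ba bna.
  have := congr1 (fun z : 'Hom(E, R^o) => cpairing z v) e'.
  rewrite val_ropp e cpairingNl !cpairingDl !cpairingMzl -!/(pr _ _) av bv !mul0rz !addr0 => /eqP.
  by rewrite eq_sym -subr_eq0 opprK -mulr2n pnatr_eq0.
rewrite (bigID (same_string a b)) /=.
rewrite [X in X + _ = _ -> _](eq_bigl (same_string a b)) => [|i]; last first.
  by case: (same_string a b i); rewrite ?andbT ?andbF.
rewrite [X in _ + X = _ -> _](eq_bigl (fun i => same_string a b (ropp i))) => [|i]; last first.
  by have := disj i; case: (same_string a b i) => [->|_] //; rewrite ?andbT ?andbF.
rewrite [X in _ + X = _ -> _](reindex_inj (inv_inj (roppK Phi_root))) /=.
under [X in _ + X = _ -> _]eq_bigl => i do rewrite roppK.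
under [X in _ + X = _ -> _]eq_bigr => i _ do rewrite t_ropp.
by rewrite -mulr2n -scaler_nat => /eqP; rewrite scaler_eq0 pnatr_eq0 => /eqP.
Qed.

End Strings.

(** * Elliptic relations *)

Section Elliptic.
Variables (R : realType) (E : vectType R) (ip : {dot E for idfun}).
Variables (Phi : {fset 'Hom(E, R^o)}) (Phi_root : root_system ip Phi).
Local Notation C := (R[i]).
Local Notation ropp := (ropp Phi_root).
Implicit Types (i j l : Phi) (u v w : cplxn E).

Variable hvec : Phi -> cplxn E.
Hypothesis pr_hvec : forall i, pr i (hvec i) = 1.

Lemma pr_hvec_ropp i : pr i (hvec (ropp i)) = -1.
Proof. by rewrite -[X in pr X _](roppK Phi_root) pr_ropp pr_hvec. Qed.

Variables (L : lieAlgType C) (t : Phi -> L) (x y : cplxn E -> L).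
Hypotheses (x_lin : linear x) (y_lin : linear y).
Hypothesis t_ropp : forall i, t (ropp i) = t i.
Hypothesis string_rel : forall a b, b != a -> b != ropp a ->
  \sum_(j | same_string a b j) [br t a, t j] = 0.
Hypothesis xx : forall u v, [br x u, x v] = 0.
Hypothesis yy : forall u v, [br y u, y v] = 0.
Hypothesis yx : forall u v,
  [br y u, x v] = 2^-1 *: \sum_i (pr i v * pr i u) *: t i.
Hypothesis tx : forall i u, pr i u = 0 -> [br t i, x u] = 0.
Hypothesis ty : forall i u, pr i u = 0 -> [br t i, y u] = 0.

Let half_double (v : L) : 2^-1 *: (v + v) = v.
Proof.
by rewrite -[v in v + v]scale1r -scalerDl scalerA mulVf ?scale1r // pnatr_eq0.
Qed.

Let scaleCA (k k' : C) (v : L) : k *: (k' *: v) = k' *: (k *: v).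
Proof. by rewrite !scalerA mulrC. Qed.

(** By brx_tau, tau i n depends on hvec i through pr i (hvec i) = 1 only. *)
Definition tau i n : L := iter n (liebr (x (hvec i))) (t i).

Lemma tauS i n : tau i n.+1 = [br x (hvec i), tau i n]. Proof. by []. Qed.

Lemma brx_comm u v z : [br x u, [br x v, z]] = [br x v, [br x u, z]].
Proof. by rewrite liebr_leibniz xx liebr0l add0r. Qed.

Lemma brx_tau u i n : [br x u, tau i n] = pr i u *: tau i n.+1.
Proof.
elim: n => [|n IH] /=; last by rewrite brx_comm IH liebrZr.
have {1}-> : u = pr i u *: hvec i + (u - pr i u *: hvec i) by rewrite addrC subrK.
rewrite x_lin liebrDl liebrZl (liebrC (x (u - _))) tx ?oppr0 ?addr0 //.
by rewrite prB prZ pr_hvec // mulr1 subrr.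
Qed.

Lemma tau_ropp i n : tau (ropp i) n = (-1) ^+ n *: tau i n.
Proof.
elim: n => [|n IH]; first by rewrite scale1r /tau /= t_ropp.
rewrite {1}/tau iterS -/(tau _ _) IH liebrZr brx_tau pr_hvec_ropp scalerA.
by rewrite exprSr.
Qed.

Lemma iter_brx_taul u i j a b p : pr j u = 0 ->
  iter p (liebr (x u)) [br tau i a, tau j b] =
  pr i u ^+ p *: [br tau i (a + p), tau j b].
Proof.
move=> ju; elim: p => [|p IH]; first by rewrite scale1r addn0.
rewrite iterS IH liebrZr liebr_leibniz !brx_tau ju scale0r liebr0r addr0.
by rewrite liebrZl scalerA exprSr addnS.
Qed.

Lemma iter_brx_taur u i j a b p : pr i u = 0 ->
  iter p (liebr (x u)) [br tau i a, tau j b] =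
  pr j u ^+ p *: [br tau i a, tau j (b + p)].
Proof.
move=> iu; elim: p => [|p IH]; first by rewrite scale1r addn0.
rewrite iterS IH liebrZr liebr_leibniz !brx_tau iu scale0r liebr0l add0r.
by rewrite liebrZr scalerA exprSr addnS.
Qed.

Lemma pr_same_string a i j u : pr a u = 0 -> same_string a i j -> pr j u = pr i u.
Proof.
move=> au /asboolP[n e]; rewrite /pr e cpairingDl cpairingMzl -/(pr a u) au.
by rewrite mul0rz addr0.
Qed.

Lemma string_rel_tau a b k : b != a -> b != ropp a ->
  \sum_(j | same_string a b j) [br t a, tau j k] = 0.
Proof.
move=> ba bna; have [u [au bu]] := dual_vector ba bna.
have lin := iter_linear k (liebr_linearr (x u)).
have := congr1 (iter k (liebr (x u))) (string_rel ba bna).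
rewrite (is_linear0 lin) (is_linear_sum lin) => e; rewrite -[RHS]e.
apply: eq_bigr => j sj.
rewrite -[X in [br _, X] = _]/(tau j k) (iter_brx_taur j 0 0 k au).
by rewrite (pr_same_string au sj) bu expr1n scale1r.
Qed.

(** Averaging over strings extends the string relation to all weights that are
    constant on strings. *)
Lemma weighted_string_rel a k (phi : Phi -> C) :
  (forall i j, same_string a i j -> phi i = phi j) ->
  phi a = 0 -> phi (ropp a) = 0 ->
  \sum_j phi j *: [br t a, tau j k] = 0.
Proof.
move=> phis phia phina.
(* each string is counted once for each of its N i roots *)
pose N i : nat := #|[pred j | same_string a i j]|.
have N0 i : (N i)%:R != 0 :> C.
  by rewrite pnatr_eq0 -lt0n; apply/card_gt0P; exists i; apply: same_string_refl.
transitivity (\sum_i (phi i / (N i)%:R) *: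
    \sum_(j | same_string a i j) [br t a, tau j k]); last first.
  apply: big1 => i _; have [->|ia] := eqVneq i a; first by rewrite phia mul0r scale0r.
  have [->|ina] := eqVneq i (ropp a); first by rewrite phina mul0r scale0r.
  by rewrite (string_rel_tau _ ia ina) scaler0.
under [RHS]eq_bigr => i _ do rewrite scaler_sumr.
rewrite (exchange_big_dep xpredT) //=; apply: eq_bigr => j _.
rewrite -scaler_suml; congr (_ *: _).
transitivity (\sum_(i | same_string a i j) phi j / (N j)%:R).
  have Ns : #|[pred i | same_string a i j]| = N j.
    by apply: eq_card => i; rewrite !inE same_string_sym.
  by rewrite sumr_const Ns -[RHS]mulr_natr (divfK (N0 j)).
apply: eq_bigr => i ij; rewrite (phis _ _ ij); congr (_ / _%:R).
apply: eq_card => l; rewrite !inE; apply/idP/idP => h.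
  exact: same_string_trans ij h.
by rewrite same_string_sym in ij; exact: same_string_trans ij h.
Qed.

Definition coplanar i j l : bool :=
  `[< exists p q r : R, (p, q, r) != 0 /\ p *: val i + q *: val j + r *: val l = 0 >].

Lemma coplanar_rot i j l : coplanar i j l -> coplanar j l i.
Proof.
move=> /asboolP[p [q [r [nz e]]]]; apply/asboolP; exists q, r, p.
split; last by rewrite -[RHS]e addrC addrA.
by move: nz; rewrite !xpair_eqE; apply: contra => /andP[/andP[-> ->] ->].
Qed.

Lemma coplanar_swap i j l : coplanar i j l -> coplanar i l j.
Proof.
move=> /asboolP[p [q [r [nz e]]]]; apply/asboolP; exists p, r, q.
split; last by rewrite -[RHS]e addrAC.
by move: nz; rewrite !xpair_eqE; apply: contra => /andP[/andP[-> ->] ->].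
Qed.

Lemma coplanar_string i j j' l : same_string i j j' -> coplanar i j l -> coplanar i j' l.
Proof.
move=> /asboolP[n ej] /asboolP[p [q [r [nz e]]]]; apply/asboolP.
exists (p - q * n%:~R), q, r; split.
  move: nz; rewrite !xpair_eqE; apply: contra => /andP[/andP[p0 /eqP q0] ->].
  by move: p0; rewrite q0 mul0r subr0 => ->; rewrite eqxx.
rewrite -[RHS]e ej scalerDr scalerBl -scalerA scaler_int; congr (_ + _).
by rewrite [q *: val j + _]addrC addrA subrK.
Qed.

Lemma coplanar_self i l : coplanar i i l.
Proof.
apply/asboolP; exists 1, (-1), 0; split; last by rewrite scale0r addr0 scaleN1r scale1r subrr.
by rewrite !xpair_eqE oner_eq0.
Qed.

Lemma coplanar_ropp i l : coplanar i (ropp i) l.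
Proof.
apply/asboolP; exists 1, 1, 0; split; last first.
  by rewrite scale0r addr0 !scale1r val_ropp subrr.
by rewrite !xpair_eqE oner_eq0.
Qed.

Definition tau_total k : L := 2^-1 *: \sum_i tau i k.

Lemma on_line_string a i j : same_string a i j ->
  (exists m : int, val i = val a *~ m) -> exists m : int, val j = val a *~ m.
Proof.
by move=> /asboolP[n ->] [m ->]; exists (m + n); rewrite mulrzDr.
Qed.

Lemma sum_pm_split (V : zmodType) (F : Phi -> V) a :
  \sum_i F i = F a + F (ropp a) +
    \sum_(i | ~~ `[< exists m : int, val i = val a *~ m >]) F i.
Proof.
have na : ropp a != a := ropp_neq Phi_root a.
rewrite (bigD1 a) //= (bigD1 (ropp a)) //= addrA; congr (_ + _).
apply: eq_bigl => i; apply/andP/idP => [[ia ina]|H].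
  apply/negP => /asboolP[m /(root_mul Phi_root)[e|e]].
    by rewrite e eqxx in ia.
  by rewrite e eqxx in ina.
split; apply/negP => /eqP e; move/negP: H; apply; apply/asboolP.
  by exists 1; rewrite e mulr1z.
by exists (-1); rewrite e val_ropp mulrNz mulr1z.
Qed.

(** The coefficient 1 off the line of a is constant along a-strings, and the two
    roots on that line contribute the same since k is even. Thus the derivation
    that sends each t_a to [t_a, tau a k] is inner on the t's, and preserves all
    relations among them. *)
Lemma br_tau_total k a : ~~ odd k -> [br t a, tau a k] = [br t a, tau_total k].
Proof.
move=> ek; pose phi i : C := (~~ `[< exists m : int, val i = val a *~ m >])%:R.
have phia : phi a = 0.
  rewrite /phi (_ : `[< _ >] = true) //.
  by apply/asboolP; exists 1; rewrite mulr1z.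
have phina : phi (ropp a) = 0.
  rewrite /phi (_ : `[< _ >] = true) //.
  by apply/asboolP; exists (-1); rewrite val_ropp mulrNz mulr1z.
have phis i j : same_string a i j -> phi i = phi j.
  move=> ij; congr (nat_of_bool (~~ _))%:R; apply/asboolP/asboolP.
    exact: on_line_string.
  by apply: on_line_string; rewrite same_string_sym.
have := weighted_string_rel k phis phia phina.
rewrite (sum_pm_split _ a) phia phina !scale0r !add0r => e.
rewrite /tau_total liebrZr liebr_sumr (sum_pm_split _ a).
rewrite tau_ropp -signr_odd (negPf ek) expr0 scale1r.
rewrite [X in _ + X](_ : _ = 0) ?addr0.
  by rewrite half_double.
by rewrite -[RHS]e; apply: eq_bigr => i; rewrite /phi => ->; rewrite scale1r.
Qed.

(** * Sums over the roots of a plane *)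

Section Plane.
Variables (a : Phi) (w : cplxn E).
Hypothesis aw : pr a w = 0.

Local Notation h := (hvec a).
(** slope i is the s for which the root i vanishes on h + s w, and area i j the
    determinant of i and j on the pair (h, w). *)
Definition slope i : C := - pr i h / pr i w.
Definition area i j : C := pr i h * pr j w - pr j h * pr i w.
Definition line_op (s : C) : L -> L := liebr (x (h + s *: w)).
Definition pot := potential (liebr (x h)) (liebr (x w)).

Lemma pencil_line_op s : pencil (liebr (x h)) (liebr (x w)) s = line_op s.
Proof.
apply/funext => v; rewrite /pencil /line_op -[h + _]addrC x_lin liebrDl liebrZl.
by rewrite addrC.
Qed.

Lemma pr_slope i : pr i w != 0 -> pr i (h + slope i *: w) = 0.
Proof. by move=> ei; rewrite prD prZ /slope divfK // subrr. Qed.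

Lemma pr_slope_area i j : pr j w != 0 -> pr i (h + slope j *: w) = area i j / pr j w.
Proof.
move=> ej; rewrite prD prZ /slope /area; apply: (mulIf ej).
by rewrite divfK // mulrDl mulrAC divfK // mulNr.
Qed.

Lemma area_anchor j : area a j = pr j w.
Proof. by rewrite /area aw mulr0 subr0 pr_hvec // mul1r. Qed.

Lemma areaC i j : area j i = - area i j.
Proof. by rewrite /area opprB. Qed.

Lemma slopeB i j : pr i w != 0 -> pr j w != 0 ->
  slope j - slope i = area i j / (pr i w * pr j w).
Proof.
move=> ei ej; rewrite /slope /area; apply: (mulIf (mulf_neq0 ei ej)).
rewrite divfK ?mulf_neq0 //.
by rewrite mulrBl mulrCA -mulrA mulVf // mulr1 mulrA divfK //; ring.
Qed.

Lemma pot_linear n s : linear (pot n s).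
Proof.
rewrite /pot; elim: n => [|n IH] k u v /=; first by rewrite scalerDr !scalerA mulrC.
have lin : linear (iter n.+1 (line_op s)) by apply: iter_linear; apply: liebr_linearr.
rewrite IH liebrDr liebrZr pencil_line_op -!iterS (is_linearD lin) (is_linearZ lin).
by rewrite !scalerDr !scalerA (mulrC s) addrACA.
Qed.

(** y(w) commutes with t_a, so only the commutators [y(w), x(h)], sums of the
    t_j, contribute; passing them one after the other reproduces the recursion
    that defines potential. *)
Lemma y_tau n : [br y w, tau a n.+1] =
  2^-1 *: \sum_(j | pr j w != 0) pr j w ^+ 2 *: pot n (slope j) [br t a, t j].
Proof.
have step k : [br [br y w, x h], tau a k] =
    2^-1 *: \sum_(j | pr j w != 0) pr j w ^+ 2 *:
       (slope j *: iter k (line_op (slope j)) [br t a, t j]).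
  rewrite yx liebrZl liebr_suml (bigID (fun j => pr j w != 0)) /=.
  rewrite [X in _ + X]big1 ?addr0 => [|j]; last first.
    by rewrite negbK => /eqP ->; rewrite mulr0 scale0r liebr0l.
  congr (_ *: _); apply: eq_bigr => j ej.
  rewrite /line_op (iter_brx_taul a 0 0 k (pr_slope ej)) add0n.
  rewrite pr_slope_area // area_anchor divff // expr1n scale1r.
  rewrite liebrZl (liebrC (t j)) scalerN -scaleNr scalerA; congr (_ *: _).
  by rewrite /slope; move: (pr j h) (pr j w) ej => p q q0; field.
have y0 : [br y w, t a] = 0 by rewrite liebrC ty ?oppr0.
elim: n => [|n IH].
  by rewrite tauS liebr_leibniz y0 liebr0r addr0 (step 0%N).
rewrite tauS liebr_leibniz step IH liebrZr -scalerDr.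
congr (_ *: _); rewrite liebr_sumr -big_split; apply: eq_bigr => j ej /=.
by rewrite liebrZr -scalerDr addrC pencil_line_op.
Qed.

Lemma coplanar_pr p q r i j l u : p *: val i + q *: val j + r *: val l = 0 ->
  (p%:C)%C * pr i u + (q%:C)%C * pr j u + (r%:C)%C * pr l u = 0.
Proof.
move=> /(congr1 (fun z : 'Hom(E, R^o) => cpairing z u)).
by rewrite !cpairingDl !cpairingZl cpairing0l.
Qed.

(** In a plane containing a on which w is not zero, only a and -a vanish on w. *)
Lemma coplanar_level i j : coplanar a i j -> pr j w != 0 -> pr i w = 0 ->
  exists m : int, val i = val a *~ m.
Proof.
move=> /asboolP[p [q [r [nz e]]]] ej ei.
have := coplanar_pr w e; rewrite aw ei !mulr0 !add0r => /eqP.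
rewrite mulf_eq0 (negPf ej) orbF => /eqP r0.
have {}r0 : r = 0 by apply: complexI; exact: r0.
have pq : (p, q) != 0.
  by move: nz; rewrite r0 !xpair_eqE eqxx andbT.
move: e; rewrite r0 scale0r addr0 => e.
have [->|->] := root_prop Phi_root pq e; first by exists 1; rewrite mulr1z.
by exists (-1); rewrite mulrNz mulr1z val_ropp.
Qed.

Definition plane_weight N i j : C := gweight N (area i j) (pr i w) (pr j w).

Lemma plane_weightC N i j : plane_weight N i j = plane_weight N j i.
Proof. by rewrite /plane_weight (areaC i j) gweightN gweight_swap. Qed.

Lemma area_string i j j' : same_string i j j' -> area i j' = area i j.
Proof.
move=> /asboolP[n e].
have E1 u : pr j' u = pr j u + pr i u *~ n by rewrite /pr e cpairingDl cpairingMzl.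
rewrite /area !E1 mulrDr mulrDl mulrzAl mulrzAr.
by rewrite opprD addrACA subrr addr0.
Qed.

Lemma plane_weight_string N i j j' : same_string i j j' ->
  plane_weight N i j = plane_weight N i j'.
Proof.
move=> ij; have /asboolP[n e] := ij.
have E1 u : pr j' u = pr j u + pr i u *~ n by rewrite /pr e cpairingDl cpairingMzl.
rewrite /plane_weight (area_string ij) E1.
rewrite [RHS]gweight_rot [RHS]gweight_rot [RHS]gweight_swap gweight_shear.
by rewrite [LHS]gweight_rot [LHS]gweight_rot [LHS]gweight_swap.
Qed.

(** Since i vanishes on h + slope i w, and j on h + slope j w, the powers of the
    two operators hit one factor of [t_i, t_j] each. *)
Lemma bracket_sum_pot n i j : pr i w != 0 -> pr j w != 0 -> area i j != 0 ->
  \sum_(p < n.+1) ((-1) ^+ (n - p) * (pr i w)^-1 ^+ (n - p).+1 * (pr j w)^-1 ^+ p.+1) *: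
     [br tau i p, tau j (n - p)] =
  (area i j)^-1 ^+ n.+1 *: (pot n (slope j) [br t i, t j] - pot n (slope i) [br t i, t j]).
Proof.
move=> ei ej Anz.
rewrite /pot -divided_difference; [|exact: liebr_linearr|exact: liebr_linearr|exact: brx_comm].
rewrite slopeB // scalerA scaler_sumr; apply: eq_bigr => p _.
rewrite !pencil_line_op (iter_brx_taur j 0 0 (n - p) (pr_slope ei)) add0n.
rewrite (pr_slope_area _ ei) (areaC i j).
rewrite (is_linearZ (iter_linear p (liebr_linearr _))).
rewrite (iter_brx_taul i 0 (n - p) p (pr_slope ej)) add0n.
rewrite (pr_slope_area _ ej) !scalerA; congr (_ *: _).
have : (n - p + p)%N = n by rewrite subnK // -ltnS.
move: (nat_of_ord p) (n - p)%N => m q <-.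
rewrite mulNr (exprNn (_ / _)) !exprMn !exprS exprD !exprVn invfM.
move: (area i j) (pr i w) (pr j w) Anz ei ej => A b c A0 b0 c0.
have Ap r : A ^+ r * A ^- r = 1 by rewrite divff // expf_neq0.
rewrite [RHS](_ : _ = (A * A^-1) * (A ^+ q * A ^- q) * (A ^+ m * A ^- m) *
   ((-1) ^+ q * (b^-1 * b ^- q) * (c^-1 * c ^- m))); last by ring.
by rewrite !Ap divff // !mul1r.
Qed.

(** The power of area i j adjusts the degree: m = 0 serves for the relation
    [t_a, y(w)] = 0, and m = c + 1 for the brackets with tau l c whose sum gives
    [y(u), y(v)] = 0. *)
Definition plane_coef N m i j p q : C :=
  if [&& coplanar a i j, pr i w != 0 & pr j w != 0] then
    plane_weight N i j * (area i j)^-1 ^+ m *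
      ((-1) ^+ q * (pr i w)^-1 ^+ q.+1 * (pr j w)^-1 ^+ p.+1)
  else 0.

Section Rows.
Variable k : nat.
Hypothesis k_even : ~~ odd k.

Definition row_weight i j : C := plane_weight k.+2 i j * (area i j)^-1 ^+ k.

Definition pair_weight i j : C :=
  if [&& coplanar a i j, pr i w != 0, pr j w != 0 & area i j != 0]
  then row_weight i j else 0.

Lemma row_weightC i j : row_weight i j = row_weight j i.
Proof.
rewrite /row_weight plane_weightC (areaC j i) invrN exprNn -signr_odd.
by rewrite (negPf k_even) mul1r.
Qed.

Lemma pair_weightC i j : pair_weight i j = pair_weight j i.
Proof.
rewrite /pair_weight row_weightC (areaC i j) oppr_eq0.
have -> : coplanar a i j = coplanar a j i by apply/idP/idP; apply: coplanar_swap.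
by case: (coplanar _ _ _) (pr i w != 0) (pr j w != 0) (area i j != 0) => [] [] [] [].
Qed.

(** At a the group of determinants is generated by pr j w, and the weight comes
    down to the coefficient of y_tau. *)
Lemma row_weight_anchor j : pr j w != 0 -> row_weight a j = pr j w ^+ 2.
Proof.
move=> ej; rewrite /row_weight /plane_weight area_anchor aw.
rewrite gweight_swap gweight_dup /= ?negbK // -addn2 exprD exprVn mulrAC divff ?mul1r //.
exact: expf_neq0.
Qed.

Lemma row_weight_ropp_anchor j : row_weight (ropp a) j = row_weight a j.
Proof.
rewrite row_weightC [RHS]row_weightC /row_weight.
have A1 : area j (ropp a) = - area j a by rewrite /area !pr_ropp; ring.
have -> : plane_weight k.+2 j (ropp a) = plane_weight k.+2 j a.
  by rewrite /plane_weight A1 pr_ropp aw oppr0 gweightN.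
by rewrite A1 invrN exprNn -signr_odd (negPf k_even) mul1r.
Qed.

(** As functions of i the weights are constant along j-strings, so the complete
    row vanishes; the sum omits its entries at i = a and i = - a. *)
Lemma row_sum j : pr j w != 0 ->
  \sum_i pair_weight i j *: [br t i, t j] = - (2 * pr j w ^+ 2) *: [br t a, t j].
Proof.
move=> ej; pose phi i : C := if coplanar a i j && (area i j != 0) then row_weight i j else 0.
have phis i i' : same_string j i i' -> phi i = phi i'.
  move=> s; rewrite /phi ![row_weight _ j]row_weightC /row_weight.
  rewrite (plane_weight_string _ s) !(areaC j) !oppr_eq0 (area_string s).
  suff -> : coplanar a i j = coplanar a i' j by [].
  apply/idP/idP => /coplanar_rot/coplanar_rot/coplanar_swap c.
    by apply/coplanar_rot/coplanar_swap; apply: coplanar_string s c.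
  rewrite same_string_sym in s.
  by apply/coplanar_rot/coplanar_swap; apply: coplanar_string s c.
have phij : phi j = 0 by rewrite /phi /area subrr eqxx andbF.
have phinj : phi (ropp j) = 0.
  by rewrite /phi /area !pr_ropp mulNr mulrN opprK addNr eqxx andbF.
have := weighted_string_rel 0 phis phij phinj.
rewrite (sum_pm_split _ a).
have off1 i : (exists m : int, val i = val a *~ m) -> pr i w = 0.
  by move=> [m em]; rewrite /pr em cpairingMzl -/(pr a w) aw mul0rz.
have pw0 i : pr i w = 0 -> pair_weight i j = 0.
  by move=> e0; rewrite /pair_weight e0 eqxx andbF.
rewrite [in X in _ -> X](sum_pm_split _ a) !(pw0 _ (off1 _ _)) ?scale0r ?add0r; last 2 first.
- by exists (-1); rewrite val_ropp mulrNz mulr1z.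
- by exists 1; rewrite mulr1z.
have pa : phi a = pr j w ^+ 2.
  by rewrite /phi coplanar_self area_anchor ej row_weight_anchor.
have pna : phi (ropp a) = pr j w ^+ 2.
  rewrite /phi coplanar_ropp row_weight_ropp_anchor row_weight_anchor //.
  by rewrite (_ : area _ _ = - pr j w) ?oppr_eq0 ?ej // -area_anchor /area !pr_ropp; ring.
rewrite pa pna [tau (ropp a) 0]t_ropp -scalerDl => e0.
transitivity (- (\sum_(i | ~~ `[< exists m : int, val i = val a *~ m >])
    phi i *: [br t j, tau i 0])).
  rewrite -sumrN; apply: eq_bigr => i /asboolP ni; rewrite -scalerN -liebrC.
  congr (_ *: _); rewrite /pair_weight /phi; case: ifP => [/andP[-> /andP[_ /andP[_ ->]]] //|].
  case: ifP => // /andP[c ->]; rewrite c ej /= andbT => /negbT; rewrite negbK => /eqP ei.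
  by case: ni; apply: coplanar_level c ej ei.
have {e0} -> : \sum_(i | ~~ `[< exists m : int, val i = val a *~ m >])
    phi i *: [br t j, tau i 0] = - ((pr j w ^+ 2 + pr j w ^+ 2) *: [br t j, tau a 0]).
  by apply/eqP; rewrite -addr_eq0 addrC e0.
rewrite opprK (liebrC (t j)) scalerN scaleNr; congr (- (_ *: _)).
by rewrite mulr_natl mulr2n.
Qed.

(** By bracket_sum_pot each pair contributes a term of slope j and a term of
    slope i, exchanged by symmetry: the sum is twice the sum of the rows. *)
Lemma plane_sum m n : (m + n.+1 = k)%N ->
  \sum_i \sum_(j | area i j != 0) \sum_(p < n.+1)
     plane_coef k.+2 m i j p (n - p) *: [br tau i p, tau j (n - p)] =
  - 8 *: [br y w, tau a n.+1].
Proof.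
move=> mnk.
pose Z i j := [br t i, t j].
pose W i j := pair_weight i j *: pot n (slope j) (Z i j).
transitivity (\sum_i \sum_j (W i j + W j i)).
  apply: eq_bigr => i _; rewrite big_mkcond; apply: eq_bigr => j _.
  rewrite /W (pair_weightC j i) [Z j i]liebrC (is_linearN (pot_linear _ _)) -scalerDr.
  rewrite /plane_coef /pair_weight; case: ifP => [Aij|/negbT Aij]; last first.
    by rewrite !andbF scale0r.
  rewrite !andbT; case: ifP => [/and3P[_ ei ej]|_]; last first.
    by rewrite scale0r big1 // => p _; rewrite scale0r.
  rewrite -/(pot _ _) /row_weight -mnk exprD mulrA -scalerA -bracket_sum_pot //.
  by rewrite scaler_sumr; apply: eq_bigr => p _; rewrite scalerA.
under eq_bigr => i _ do rewrite big_split /=.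
rewrite big_split /= [X in X + _]exchange_big /= -big_split /= y_tau scalerA.
rewrite [in RHS]big_mkcond scaler_sumr; apply: eq_bigr => j _ /=.
have row : \sum_i W i j = pot n (slope j) (\sum_i pair_weight i j *: Z i j).
  rewrite (is_linear_sum (pot_linear _ _)); apply: eq_bigr => i _.
  by rewrite (is_linearZ (pot_linear _ _)).
have [ej|ej] := eqVneq (pr j w) 0.
  rewrite /= scaler0; rewrite row big1 ?(is_linear0 (pot_linear _ _)) ?addr0 // => i _.
  by rewrite /pair_weight ej eqxx !andbF scale0r.
rewrite row row_sum // (is_linearZ (pot_linear _ _)) -scalerDl scalerA; congr (_ *: _).
by field.
Qed.
End Rows.

(** For coplanar roots area is a nonzero multiple of the area form of the plane,
    so that it detects parallel roots. *)
Lemma coplanar_area0 i j : coplanar a i j -> pr j w != 0 -> area i j = 0 ->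
  j = i \/ j = ropp i.
Proof.
move=> /asboolP[p [q [r [nz e]]]] ej A0.
have ew := coplanar_pr w e; have eh := coplanar_pr h e.
rewrite aw mulr0 add0r in ew; rewrite pr_hvec mulr1 in eh.
have p0 : (p%:C)%C = 0.
  apply: (mulIf ej); rewrite mul0r -[RHS](mul0r (pr j w)) -[X in _ = X * _]eh.
  apply/eqP; rewrite -subr_eq0; apply/eqP.
  transitivity (- (q%:C)%C * area i j - pr j h * ((q%:C)%C * pr i w + (r%:C)%C * pr j w)).
    by rewrite /area; ring.
  by rewrite A0 ew !mulr0 subr0.
have {}p0 : p = 0 by apply: complexI; exact: p0.
apply: (root_prop Phi_root (a := q) (b := r)).
  by move: nz; rewrite p0 !xpair_eqE eqxx.
by rewrite -[RHS]e p0 scale0r add0r.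
Qed.

Lemma plane_coef_level0 N m i j p q : pr i w = 0 -> plane_coef N m i j p q = 0.
Proof. by move=> ei; rewrite /plane_coef ei eqxx andbF. Qed.

Lemma plane_coef0 N i j p q : plane_coef N 0 i j p q =
  if [&& coplanar a i j, pr i w != 0 & pr j w != 0] then
    plane_weight N i j * ((-1) ^+ q * (pr i w)^-1 ^+ q.+1 * (pr j w)^-1 ^+ p.+1)
  else 0.
Proof. by rewrite /plane_coef (expr0 (area i j)^-1) (mulr1 (plane_weight N i j)). Qed.

Lemma plane_coefC N i j p q : plane_coef N 0 i j p q = (-1) ^+ (p + q) * plane_coef N 0 j i q p.
Proof.
rewrite !plane_coef0 (plane_weightC N i j).
have -> : coplanar a i j = coplanar a j i by apply/idP/idP; apply: coplanar_swap.
rewrite [(pr j w != 0) && _]andbC; case: ifP => _; last by rewrite mulr0.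
rewrite exprD; have : ((-1) ^+ p * (-1) ^+ p : C) = 1 by rewrite -exprMn mulrNN mulr1 expr1n.
move: ((-1) ^+ p : C) => z zz.
transitivity (z * z * (plane_weight N j i * ((-1) ^+ q * (pr i w)^-1 ^+ q.+1 * (pr j w)^-1 ^+ p.+1))).
  by rewrite zz mul1r.
by ring.
Qed.

Lemma plane_coef_stringl N i i' j p q : same_string a i i' ->
  plane_coef N 0 i j p q = plane_coef N 0 i' j p q.
Proof.
move=> s; rewrite !plane_coef0 (pr_same_string aw s).
have -> : coplanar a i j = coplanar a i' j.
  apply/idP/idP; first exact: coplanar_string s.
  by rewrite same_string_sym in s; apply: coplanar_string s.
have -> // : plane_weight N i j = plane_weight N i' j.
rewrite /plane_weight (pr_same_string aw s).
have /asboolP[n e] := s.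
have -> : area i' j = area i j + pr j w *~ n.
  rewrite /area (pr_same_string aw s) {1}/pr e cpairingDl cpairingMzl -/(pr _ _) -/(pr _ _).
  by rewrite pr_hvec mulrDl mulrzAl mul1r addrAC.
by rewrite [LHS]gweight_swap [RHS]gweight_swap gweight_shear.
Qed.

Lemma plane_coef_stringr N i j j' p q : same_string a j j' ->
  plane_coef N 0 i j p q = plane_coef N 0 i j' p q.
Proof.
by move=> s; rewrite plane_coefC [RHS]plane_coefC (plane_coef_stringl _ _ _ _ s).
Qed.

Lemma plane_coef_level0r N i j p q : pr j w = 0 -> plane_coef N 0 i j p q = 0.
Proof. by move=> ej; rewrite plane_coefC plane_coef_level0 // mulr0. Qed.

Definition full_plane_sum N n : L :=
  \sum_i \sum_j \sum_(p < n.+1)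
    plane_coef N 0 i j p (n - p) *: [br tau i p, tau j (n - p)].

Lemma pr_ropp_anchor : pr (ropp a) w = 0.
Proof. by rewrite pr_ropp aw oppr0. Qed.

(** The coefficients with m = 0 do not involve area i j outside the lattice
    weight, so they are constant along a-strings in i as well as in j. *)
Lemma br_full_plane_sum N n : [br t a, full_plane_sum N n] = 0.
Proof.
rewrite /full_plane_sum liebr_sumr.
transitivity (\sum_i \sum_j \sum_(p < n.+1)
    ([br plane_coef N 0 i j p (n - p) *: [br t a, tau i p], tau j (n - p)] +
     [br tau i p, plane_coef N 0 i j p (n - p) *: [br t a, tau j (n - p)]])).
  apply: eq_bigr => i _; rewrite liebr_sumr; apply: eq_bigr => j _.
  rewrite liebr_sumr; apply: eq_bigr => p _.
  by rewrite liebrZr liebr_leibniz scalerDr liebrZl liebrZr.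
under eq_bigr => i _ do under eq_bigr => j _ do rewrite big_split /=.
under eq_bigr => i _ do rewrite big_split /=.
rewrite big_split /= [X in X + _]exchange_big /= big1 ?add0r => [|j _]; last first.
  rewrite exchange_big big1 // => p _; rewrite -liebr_suml.
  rewrite (weighted_string_rel p (phi := fun i => plane_coef N 0 i j p (n - p))).
  - by rewrite liebr0l.
  - by move=> i i'; apply: plane_coef_stringl.
  - exact: plane_coef_level0.
  - by apply: plane_coef_level0; apply: pr_ropp_anchor.
apply: big1 => i _; rewrite exchange_big big1 // => p _; rewrite -liebr_sumr.
rewrite (weighted_string_rel (n - p) (phi := fun j => plane_coef N 0 i j p (n - p))).
- by rewrite liebr0r.
- by move=> j j'; apply: plane_coef_stringr.
- exact: plane_coef_level0r.
- by apply: plane_coef_level0r; apply: pr_ropp_anchor.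
Qed.

End Plane.

(** * Preservation of the relations that involve y *)

Definition alt_sum n i : L :=
  \sum_(p < n.+1) (-1) ^+ (n - p) *: [br tau i p, tau i (n - p)].

Definition delta_y n u : L := 4^-1 *: \sum_i pr i u *: alt_sum n i.

Section Diagonal.
Variables (a : Phi) (w : cplxn E).
Hypothesis aw : pr a w = 0.
Variable n : nat.
Hypothesis n_odd : odd n.

(** The exponent of the weight is chosen for this: on parallel roots the
    coefficients are those of delta_y. *)
Lemma plane_coef_diag i p : (p <= n)%N -> pr i w != 0 ->
  plane_coef a w n.+3 0 i i p (n - p) = (-1) ^+ (n - p) * pr i w.
Proof.
move=> pn ei; rewrite plane_coef0 (coplanar_rot (coplanar_rot (coplanar_self i a))) ei /=.
rewrite /plane_weight /area subrr.
rewrite gweight_rot gweight_dup /= ?negbK //.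
have -> : n.+3 = (1 + (n - p).+1 + p.+1)%N by lia.
rewrite !exprD expr1 !exprVn; move: (n - p)%N => q.
have Er r : pr i w ^+ r * pr i w ^- r = 1 by rewrite divff // expf_neq0.
transitivity ((-1) ^+ q * pr i w * (pr i w ^+ q.+1 * pr i w ^- q.+1) *
  (pr i w ^+ p.+1 * pr i w ^- p.+1)); last by rewrite !Er !mulr1.
move: (pr i w ^+ q.+1) (pr i w ^- q.+1) (pr i w ^+ p.+1) (pr i w ^- p.+1) ((-1) ^+ q) (pr i w).
by move=> x1 x2 x3 x4 x5 x6; ring.
Qed.

Lemma plane_coef_antidiag i p : (p <= n)%N -> pr i w != 0 ->
  plane_coef a w n.+3 0 i (ropp i) p (n - p) *: [br tau i p, tau (ropp i) (n - p)] =
  ((-1) ^+ (n - p) * pr i w) *: [br tau i p, tau i (n - p)].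
Proof.
move=> pn ei; rewrite tau_ropp liebrZr scalerA; congr (_ *: _).
rewrite -(plane_coef_diag pn ei) !plane_coef0 (coplanar_rot (coplanar_rot (coplanar_self i a))).
rewrite (coplanar_rot (coplanar_rot (coplanar_ropp i a))) pr_ropp oppr_eq0 ei /=.
have -> : plane_weight a w n.+3 i (ropp i) = plane_weight a w n.+3 i i.
  rewrite /plane_weight pr_ropp.
  have -> : area a w i (ropp i) = area a w i i by rewrite /area !pr_ropp; ring.
  by rewrite [LHS]gweight_rot [LHS]gweight_rot gweightN [RHS]gweight_rot [RHS]gweight_rot.
rewrite invrN (exprNn (pr i w)^-1).
have sgn : ((-1) ^+ p.+1 * (-1) ^+ (n - p) : C) = 1.
  rewrite -exprD (_ : (p.+1 + (n - p) = n.+1)%N); last by lia.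
  by rewrite -signr_odd /= n_odd expr0.
rewrite -[RHS]mulr1 -[X in _ = _ * X]sgn.
move: (plane_weight _ _ _ _ _) ((pr i w)^-1 ^+ (n - p).+1) ((pr i w)^-1 ^+ p.+1).
move: ((-1) ^+ p.+1 : C) ((-1) ^+ (n - p) : C).
by move=> x1 x2 x3 x4 x5; ring.
Qed.

(** The parallel pairs (i, i) and (i, - i), which plane_sum leaves out,
    contribute delta_y. *)
Lemma full_plane_sumE :
  full_plane_sum a w n.+3 n = 8 *: (delta_y n w - [br y w, tau a n.+1]).
Proof.
have k_even : ~~ odd n.+1 by rewrite /= negbK.
rewrite /full_plane_sum.
transitivity (\sum_i (\sum_(j | area a w i j != 0) \sum_(p < n.+1)
     plane_coef a w n.+3 0 i j p (n - p) *: [br tau i p, tau j (n - p)] +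
     (2 * pr i w) *: alt_sum n i)); last first.
  rewrite big_split /= (plane_sum aw k_even (m := 0) (n := n) erefl).
  rewrite addrC scalerBr; congr (_ + _); last by rewrite -scaleNr.
  rewrite /delta_y scalerA scaler_sumr; apply: eq_bigr => i _; rewrite scalerA.
  by congr (_ *: _); field.
apply: eq_bigr => i _; rewrite (bigID (fun j => area a w i j != 0)) /=; congr (_ + _).
have [ei|ei] := eqVneq (pr i w) 0.
  rewrite ei mulr0 scale0r big1 // => j _; rewrite big1 // => p _.
  by rewrite plane_coef_level0 // scale0r.
have ni : ropp i != i := ropp_neq Phi_root i.
rewrite (bigD1 i) /=; last by rewrite negbK /area subrr eqxx.
rewrite (bigD1 (ropp i)) /=; last first.
  by rewrite negbK ni andbT /area !pr_ropp; apply/eqP; ring.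
rewrite [X in _ + (_ + X)]big1 ?addr0 => [|j /andP[/andP[]]]; last first.
  rewrite negbK => /eqP A0 ji jni; rewrite big1 // => p _.
  rewrite /plane_coef; case: ifP => [/and3P[c _ ej]|]; last by rewrite scale0r.
  by have [e|e] := coplanar_area0 aw c ej A0; [rewrite e eqxx in ji|rewrite e eqxx in jni].
rewrite -big_split scaler_sumr; apply: eq_bigr => p _ /=.
have pn : (p <= n)%N by rewrite -ltnS.
rewrite [X in _ + X = _](plane_coef_antidiag pn ei).
rewrite [X in X *: _ + _ = _](plane_coef_diag pn ei).
rewrite -scalerDl.
rewrite scalerA.
by congr (_ *: _); move: ((-1) ^+ (n - p) : C) (pr i w) => z z'; ring.
Qed.

(** The linearised form of [t_a, y(w)] = 0. *)
Lemma br_t_delta_y : [br t a, delta_y n w] = [br t a, [br y w, tau a n.+1]].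
Proof.
have := br_full_plane_sum aw n.+3 n; rewrite full_plane_sumE liebrZr => /eqP.
rewrite scaler_eq0 pnatr_eq0 /= liebrDr liebrNr subr_eq0 => /eqP //.
Qed.

End Diagonal.

(** The terms of alt_sum are symmetric under p <-> n - p because n is odd. *)
Lemma br_alt_sum b n i : odd n -> [br b, t i] = 0 ->
  [br b, alt_sum n i] =
  2 *: \sum_(c < n) (-1) ^+ c *: [br [br b, tau i (n - c)], tau i c].
Proof.
move=> on bt; pose F p := (-1) ^+ (n - p) *: [br [br b, tau i p], tau i (n - p)].
have -> : [br b, alt_sum n i] = \sum_(p < n.+1) F p + \sum_(p < n.+1) F p.
  rewrite {2}[\sum_(p < _) F p](reindex_inj rev_ord_inj) -big_split /=.
  rewrite /alt_sum liebr_sumr; apply: eq_bigr => p _.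
  have pn : (p <= n)%N by rewrite -ltnS.
  rewrite liebrZr liebr_leibniz scalerDr subSS; congr (_ + _).
  rewrite /F subKn // liebrC scalerN -scaleNr; congr (_ *: _).
  have s2 r : ((-1) ^+ r * (-1) ^+ r : C) = 1 by rewrite -exprMn mulrNN mulr1 expr1n.
  have : ((-1) ^+ (n - p) * (-1) ^+ p : C) = -1.
    by rewrite -exprD subnK // -signr_odd on.
  move=> e; transitivity (- ((-1) ^+ (n - p) * ((-1) ^+ p * (-1) ^+ p)) : C).
    by rewrite s2 mulr1.
  by rewrite mulrA e mulN1r opprK.
rewrite -mulr2n -[LHS]scaler_nat; congr (_ *: _).
rewrite big_ord_recl {1}/F bt liebr0l scaler0 add0r.
rewrite (reindex_inj rev_ord_inj); apply: eq_bigr => c _ /=.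
have cn : (c < n)%N by [].
rewrite /F /bump add1n (_ : (n - c.+1).+1 = n - c)%N; last by lia.
by rewrite subKn // ltnW.
Qed.

(** Three times the sum is the sum of the weighted Jacobi identities. *)
Lemma jacobi_sum (T : finType) (b : T -> L) (M : T -> T -> T -> C) :
  (forall I J K, M I J K = M J K I) ->
  \sum_I \sum_J \sum_K M I J K *: [br [br b I, b J], b K] = 0.
Proof.
move=> Mrot; set X := LHS.
have rot (F : T -> T -> T -> L) :
    \sum_I \sum_J \sum_K F I J K = \sum_I \sum_J \sum_K F J K I.
  rewrite [RHS](exchange_big) /=; under [RHS]eq_bigr => J _ do rewrite exchange_big /=.
  by [].
pose B I J K := [br [br b I, b J], b K].
have X1 : X = \sum_I \sum_J \sum_K M I J K *: B J K I.
  rewrite /X rot; do 3![apply: eq_bigr => ? _]; by rewrite -Mrot.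
have X2 : X = \sum_I \sum_J \sum_K M I J K *: B K I J.
  rewrite /X rot rot; do 3![apply: eq_bigr => ? _]; by rewrite -Mrot -Mrot.
have : X + X + X = 0.
  rewrite {2}X1 {2}X2 /X -!big_split big1 //= => I _.
  rewrite -!big_split big1 //= => J _; rewrite -!big_split big1 //= => K _.
  rewrite -!scalerDr -[RHS](scaler0 _ (M I J K)); congr (_ *: _).
  rewrite -[RHS]oppr0 -[in RHS](liebr_jacobi (b I) (b J) (b K)).
  rewrite !opprD -!liebrC -addrA addrC; congr (_ + _).
by rewrite -mulr2n -mulrSr -scaler_nat => /eqP; rewrite scaler_eq0 pnatr_eq0 => /eqP.
Qed.

Lemma antidiagonal_sum (V : zmodType) n c (F : nat -> nat -> V) : (c <= n)%N ->
  \sum_(p < n.+1) \sum_(q < n.+1) (if (p + q + c == n)%N then F p q else 0) =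
  \sum_(p < (n - c).+1) F p (n - c - p)%N.
Proof.
move=> cn; rewrite (big_ord_widen n.+1 (fun p => F p (n - c - p)%N)) ?ltnS ?leq_subr //.
rewrite [RHS]big_mkcond; apply: eq_bigr => p _; rewrite -big_mkcond /=.
case: ifP => [|/negbT]; rewrite ltnS => pnc; last first.
  by rewrite big_pred0 // => q; apply/negbTE/negP => /eqP; lia.
rewrite (big_pred1 (inord (n - c - p))) => [|q].
  by rewrite inordK // ltnS; lia.
rewrite /= -(inj_eq val_inj) /= inordK ?ltnS; last by lia.
by apply/eqP/eqP; lia.
Qed.

Section Wedge.
Variables (u v : cplxn E) (n : nat).
Hypothesis n_even : ~~ odd n.

Definition wedge i j : C := pr i u * pr j v - pr i v * pr j u.
Definition wedge_vec l : cplxn E := pr l v *: u - pr l u *: v.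

Lemma pr_wedge_vec i l : pr i (wedge_vec l) = wedge i l.
Proof. by rewrite prB !prZ /wedge (mulrC (pr l v)) (mulrC (pr l u)). Qed.

Lemma wedgeC i j : wedge i j = - wedge j i.
Proof. by rewrite /wedge opprB; congr (_ - _); apply: mulrC. Qed.

Lemma wedgexx i : wedge i i = 0.
Proof. by rewrite /wedge mulrC subrr. Qed.

Lemma pr_wedge_vec_self l : pr l (wedge_vec l) = 0.
Proof. by rewrite pr_wedge_vec wedgexx. Qed.

(** The two area forms of the plane of i, j, l agree up to sign because they do
    on the pair (l, j). *)
Lemma area_wedge l i j : coplanar l i j -> wedge j l != 0 ->
  area l (wedge_vec l) i j = - wedge i j.
Proof.
move=> /asboolP[p [q [r [nz e]]]] jl.
have el := coplanar_pr (wedge_vec l) e; have ej := coplanar_pr (wedge_vec j) e.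
have eh := coplanar_pr (hvec l) e.
rewrite !pr_wedge_vec wedgexx mulr0 add0r in el.
rewrite !pr_wedge_vec wedgexx mulr0 addr0 in ej.
rewrite pr_hvec mulr1 in eh.
have q0 : (q%:C)%C != 0.
  apply/eqP => q0; move: el eh; rewrite q0 !mul0r add0r => /eqP.
  rewrite mulf_eq0 (negPf jl) orbF => /eqP r0; rewrite r0 mul0r !addr0 => p0.
  have cI (z : R) : (z%:C)%C = 0 -> z = 0 by move=> z0; apply: complexI; exact: z0.
  by move/eqP: nz; rewrite (cI _ p0) (cI _ q0) (cI _ r0).
apply: (mulfI q0); rewrite /area !pr_wedge_vec.
transitivity ((q%:C)%C * pr i (hvec l) * wedge j l -
    pr j (hvec l) * ((q%:C)%C * wedge i l)); first by ring.
have -> : (q%:C)%C * wedge i l = - ((r%:C)%C * wedge j l).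
  by apply/eqP; rewrite -addr_eq0 el.
have -> : (q%:C)%C * - wedge i j = (p%:C)%C * wedge l j.
  by apply/eqP; rewrite mulrN eq_sym -addr_eq0 ej.
rewrite (wedgeC l j).
have -> : (p%:C)%C = - ((q%:C)%C * pr i (hvec l) + (r%:C)%C * pr j (hvec l)).
  by apply/eqP; rewrite -addr_eq0 addrA eh.
by ring.
Qed.

(** The coefficient of the plane sum at l, with w = wedge_vec l, written so that
    the three roots play the same role. *)
Definition triple_coef (p q c : nat) i j l : C :=
  if [&& coplanar i j l, wedge i j != 0, wedge j l != 0 & wedge l i != 0] then
    gweight n.+4 (wedge i j) (wedge j l) (wedge l i) *
    ((wedge i j)^-1 ^+ c.+1 * (wedge j l)^-1 ^+ p.+1 * (wedge l i)^-1 ^+ q.+1)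
  else 0.

Lemma triple_coef_rot p q c i j l : triple_coef p q c i j l = triple_coef q c p j l i.
Proof.
rewrite /triple_coef.
have -> : coplanar i j l = coplanar j l i.
  by apply/idP/idP => [/coplanar_rot //|/coplanar_rot/coplanar_rot].
have -> : [&& coplanar j l i, wedge i j != 0, wedge j l != 0 & wedge l i != 0] =
          [&& coplanar j l i, wedge j l != 0, wedge l i != 0 & wedge i j != 0].
  by case: (coplanar _ _ _) (wedge i j != 0) (wedge j l != 0) (wedge l i != 0) => [] [] [] [].
case: ifP => // _.
by rewrite gweight_rot; congr (_ * _); rewrite -mulrA mulrC.
Qed.

Lemma triple_coefE p q c i j l :
  triple_coef p q c i j l = (-1) ^+ c *
    (if area l (wedge_vec l) i j != 0
     then plane_coef l (wedge_vec l) n.+4 c.+1 i j p q else 0).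
Proof.
rewrite /triple_coef /plane_coef !pr_wedge_vec (wedgeC i l) oppr_eq0.
have -> : coplanar i j l = coplanar l i j.
  by apply/idP/idP => [/coplanar_rot/coplanar_rot //|/coplanar_rot].
have [c0|] := boolP (coplanar l i j); last by case: ifP; rewrite mulr0.
have [jl0|jl] := eqVneq (wedge j l) 0; first by rewrite !andbF; case: ifP; rewrite mulr0.
have [li0|li] := eqVneq (wedge l i) 0; first by rewrite !andbF; case: ifP; rewrite mulr0.
rewrite (area_wedge c0 jl) oppr_eq0 !andbT /=.
have [ij0|ij] := eqVneq (wedge i j) 0; first by rewrite mulr0.
have -> : plane_weight l (wedge_vec l) n.+4 i j =
    gweight n.+4 (wedge i j) (wedge j l) (wedge l i).
  rewrite /plane_weight (area_wedge c0 jl) !pr_wedge_vec (wedgeC i l) gweightN.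
  by rewrite [LHS]gweight_rot gweightN [LHS]gweight_swap [LHS]gweight_rot.
rewrite !invrN (exprNn (wedge i j)^-1) (exprNn (wedge l i)^-1).
have s2 r : ((-1) ^+ r * (-1) ^+ r.+1 : C) = -1.
  by rewrite exprS mulrCA -exprMn mulrNN mulr1 expr1n mulr1.
transitivity (gweight n.+4 (wedge i j) (wedge j l) (wedge l i) *
  ((wedge i j)^-1 ^+ c.+1 * (wedge j l)^-1 ^+ p.+1 * (wedge l i)^-1 ^+ q.+1) *
  (((-1) ^+ c * (-1) ^+ c.+1) * ((-1) ^+ q * (-1) ^+ q.+1))).
  by rewrite !s2 mulrNN !mulr1.
move: (gweight _ _ _ _) ((wedge i j)^-1 ^+ c.+1) ((wedge j l)^-1 ^+ p.+1) ((wedge l i)^-1 ^+ q.+1).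
move: ((-1) ^+ c.+1 : C) ((-1) ^+ q.+1 : C) ((-1) ^+ c : C) ((-1) ^+ q : C).
by move=> x1 x2 x3 x4 x5 x6 x7 x8 /=; ring.
Qed.

Lemma triple_sum l c : (c <= n)%N ->
  \sum_i \sum_j \sum_(p < n.+1) \sum_(q < n.+1)
    (if (p + q + c == n)%N then triple_coef p q c i j l *: [br tau i p, tau j q] else 0) =
  ((-1) ^+ c * - 8) *: [br y (wedge_vec l), tau l (n - c).+1].
Proof.
move=> cn; have k_even : ~~ odd n.+2 by rewrite /= negbK.
rewrite -scalerA -(plane_sum (pr_wedge_vec_self l) k_even (m := c.+1)); last by lia.
rewrite scaler_sumr; apply: eq_bigr => i _.
rewrite [X in _ = _ *: X]big_mkcond scaler_sumr; apply: eq_bigr => j _.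
rewrite (antidiagonal_sum (fun p q => triple_coef p q c i j l *: [br tau i p, tau j q]) cn).
case: ifP => A0.
  by rewrite scaler_sumr; apply: eq_bigr => p _; rewrite triple_coefE A0 scalerA.
by rewrite scaler0 big1 // => p _; rewrite triple_coefE A0 mulr0 scale0r.
Qed.

(** For fixed l and c the plane sum at l is a multiple of
    [y (wedge_vec l), tau l (n - c).+1], and these brackets with tau l c add up
    to [y (wedge_vec l), alt_sum n.+1 l]. The sum over i, j and l together has
    rotation invariant coefficients, so jacobi_sum applies. *)
Lemma wedge_alt_sum : \sum_l [br y (wedge_vec l), alt_sum n.+1 l] = 0.
Proof.
have y0 l : [br y (wedge_vec l), t l] = 0.
  by rewrite liebrC (ty (pr_wedge_vec_self l)) oppr0.
pose T : finType := (Phi * 'I_n.+1)%type.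
pose M (I J K : T) : C := if (I.2 + J.2 + K.2 == n)%N
  then triple_coef I.2 J.2 K.2 I.1 J.1 K.1 else 0.
have Mrot I J K : M I J K = M J K I.
  by rewrite /M triple_coef_rot (_ : (I.2 + J.2 + K.2 = J.2 + K.2 + I.2)%N) //; lia.
have := jacobi_sum (fun I : T => tau I.1 I.2) Mrot.
have -> : \sum_I \sum_J \sum_K M I J K *: [br [br tau I.1 I.2, tau J.1 J.2], tau K.1 K.2] =
  \sum_K [br \sum_I \sum_J M I J K *: [br tau I.1 I.2, tau J.1 J.2], tau K.1 K.2].
  under eq_bigr => I _ do rewrite exchange_big /=.
  rewrite exchange_big /=; apply: eq_bigr => K _.
  rewrite liebr_suml; apply: eq_bigr => I _; rewrite liebr_suml; apply: eq_bigr => J _.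
  by rewrite liebrZl.
move=> e.
have : (- 4^-1) *: (\sum_(K : T) [br \sum_I \sum_J M I J K *: [br tau I.1 I.2, tau J.1 J.2],
     tau K.1 K.2]) = 0 by rewrite e scaler0.
move=> {e} e; rewrite -[RHS]e scaler_sumr.
rewrite -(pair_bigA _ (fun (l : Phi) (c : 'I_n.+1) => - 4^-1 *:
  [br \sum_I \sum_J M I J (l, c) *: [br tau I.1 I.2, tau J.1 J.2], tau l c])) /=.
apply: eq_bigr => l _.
rewrite br_alt_sum //= scaler_sumr; apply: eq_bigr => c _.
have cn : (c <= n)%N by rewrite -ltnS.
transitivity (- 4^-1 *: [br ((-1) ^+ c * - 8) *: [br y (wedge_vec l), tau l (n - c).+1], tau l c]).
  rewrite subSn // liebrZl !scalerA; congr (_ *: _); by field.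
rewrite -triple_sum //; congr (_ *: [br _, _]).
rewrite -(pair_bigA _ (fun i (p : 'I_n.+1) => \sum_J M (i, p) J (l, c) *: [br tau i p, tau J.1 J.2])) /=.
apply: eq_bigr => i _; rewrite exchange_big /=; apply: eq_bigr => p _.
rewrite -(pair_bigA _ (fun j (q : 'I_n.+1) => M (i, p) (j, q) (l, c) *: [br tau i p, tau j q])) /=.
apply: eq_bigr => j _; apply: eq_bigr => q _.
by rewrite /M /=; case: ifP => // _; rewrite scale0r.
Qed.

(** The linearised form of [y(u), y(v)] = 0. *)
Lemma delta_y_comm : [br delta_y n.+1 u, y v] + [br y u, delta_y n.+1 v] = 0.
Proof.
rewrite liebrC /delta_y !liebrZr -scalerN -scalerDr !liebr_sumr -sumrN -big_split /=.
rewrite -[RHS](scaler0 _ 4^-1) -[in RHS]wedge_alt_sum; congr (_ *: _).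
apply: eq_bigr => l _; rewrite /wedge_vec (is_linearB y_lin) !(is_linearZ y_lin).
by rewrite !liebrDl liebrNl !liebrZl !liebrZr addrC.
Qed.

End Wedge.

Lemma alt_sum_ropp n i : odd n -> alt_sum n (ropp i) = - alt_sum n i.
Proof.
move=> on; rewrite /alt_sum -sumrN; apply: eq_bigr => p _.
rewrite !tau_ropp liebrZl liebrZr -scalerN -scaleN1r; congr (_ *: _).
have pn : (p <= n)%N by rewrite -ltnS.
rewrite scalerA -exprD (subnKC pn).
by rewrite -signr_odd on expr1.
Qed.

Lemma delta_y_linear n : linear (delta_y n).
Proof.
move=> k u v; rewrite /delta_y scalerA mulrC -scalerA -scalerDr; congr (_ *: _).
rewrite scaler_sumr -big_split /=; apply: eq_bigr => i _.
by rewrite prD prZ scalerDl scalerA.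
Qed.

(** ad x telescopes along the alternating sum, leaving its two end terms, which
    are equal because n is odd. *)
Lemma brx_alt_sum v n i : odd n ->
  [br x v, alt_sum n i] = - (2 * pr i v) *: [br t i, tau i n.+1].
Proof.
move=> on; pose G p := (-1) ^+ (n.+1 - p) *: [br tau i p, tau i (n.+1 - p)].
transitivity (pr i v *: (\sum_(0 <= p < n.+1) (G p.+1 - G p))).
  rewrite big_mkord scaler_sumr /alt_sum liebr_sumr; apply: eq_bigr => p _.
  have pn : (p <= n)%N by rewrite -ltnS.
  rewrite liebrZr liebr_leibniz !brx_tau liebrZl liebrZr -scalerDr.
  rewrite scalerA mulrC -scalerA /G subSS subSn // scalerDr; congr (_ *: (_ + _)).
  by rewrite exprS mulN1r scaleNr opprK.
rewrite telescope_sumr // /G subnn expr0 scale1r subn0 -signr_odd /= on expr0 scale1r.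
rewrite (liebrC (tau i n.+1)) -opprD -mulr2n -[X in - X]scaler_nat scalerN scalerA scaleNr.
by rewrite mulrC.
Qed.

Lemma br_delta_y_x u v n : odd n ->
  [br delta_y n u, x v] = 2^-1 *: \sum_i (pr i v * pr i u) *: [br t i, tau i n.+1].
Proof.
move=> on; rewrite liebrC /delta_y liebrZr liebr_sumr -scalerN -sumrN.
have -> : 2^-1 = 4^-1 * 2 :> C by field.
rewrite -scalerA; congr (_ *: _); rewrite scaler_sumr; apply: eq_bigr => i _.
rewrite liebrZr brx_alt_sum // scaleNr scalerN opprK !scalerA; congr (_ *: _); ring.
Qed.

(** * Derivations that act on the generators x and y as sl2 does *)

Section DerivationActions.
Variable D : Der L.
Hypothesis Dt : forall i, D (t i) = 0.

Lemma der_tau_killed : (forall u, D (x u) = 0) -> forall i n, D (tau i n) = 0.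
Proof.
move=> Dx i; elim=> [|n IH]; first exact: Dt.
by rewrite tauS der_br_leibniz Dx IH liebr0l liebr0r addr0.
Qed.

Lemma der_delta_y_killed : (forall u, D (x u) = 0) -> forall n u, D (delta_y n u) = 0.
Proof.
move=> Dx n u; rewrite /delta_y derZ der_sum big1 ?scaler0 // => i _.
rewrite derZ /alt_sum der_sum big1 ?scaler0 // => p _.
by rewrite derZ der_br_leibniz !der_tau_killed // liebr0l liebr0r addr0 scaler0.
Qed.

Lemma der_tau_degree : (forall u, D (x u) = x u) -> forall i n, D (tau i n) = n%:R *: tau i n.
Proof.
move=> Dx i; elim=> [|n IH]; first by rewrite scale0r; exact: Dt.
by rewrite tauS der_br_leibniz Dx IH liebrZr -[X in X + _]scale1r -scalerDl -mulrS.
Qed.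

Lemma der_delta_y_degree : (forall u, D (x u) = x u) ->
  forall n u, D (delta_y n u) = n%:R *: delta_y n u.
Proof.
move=> Dx n u; rewrite /delta_y derZ der_sum [RHS]scaleCA; congr (_ *: _).
rewrite scaler_sumr; apply: eq_bigr => i _; rewrite derZ [RHS]scaleCA; congr (_ *: _).
rewrite /alt_sum der_sum scaler_sumr; apply: eq_bigr => p _.
have pn : (p <= n)%N by rewrite -ltnS.
rewrite derZ [RHS]scaleCA; congr (_ *: _).
by rewrite der_br_leibniz !der_tau_degree // liebrZl liebrZr -scalerDl -natrD subnKC.
Qed.

Hypotheses (Dx : forall u, D (x u) = y u) (Dy : forall u, D (y u) = 0).

Lemma der_tau_nilp i n : iter n.+1 D (tau i n) = 0.
Proof.
elim: n => [|n IH]; first exact: Dt.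
by rewrite tauS -[n.+1]add1n; apply: iter_der_nilp => //=; rewrite Dx Dy.
Qed.

Lemma der_delta_y_nilp n u : iter n.+1 D (delta_y n u) = 0.
Proof.
have lin := iter_linear n.+1 (derP D).1.
rewrite /delta_y (is_linearZ lin) (is_linear_sum lin) big1 ?scaler0 // => i _.
rewrite (is_linearZ lin) /alt_sum (is_linear_sum lin) big1 ?scaler0 // => p _.
have pn : (p <= n)%N by rewrite -ltnS.
have := iter_der_nilp (der_tau_nilp i p) (der_tau_nilp i (n - p)).
by rewrite (subnKC pn) (is_linearZ lin) => ->; rewrite scaler0.
Qed.

Lemma der_br_t_tau_nilp i n : iter n.+1 D [br t i, tau i n] = 0.
Proof.
rewrite -{1}[n]add0n; apply: iter_der_nilp; [exact: Dt|exact: der_tau_nilp].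
Qed.

End DerivationActions.

End Elliptic.

(** * The derivations of the elliptic Lie algebra *)

Section EllipticPresentation.
Variables (R : realType) (E : vectType R) (ip : {dot E for idfun}).
Variables (Phi : {fset 'Hom(E, R^o)}) (P : {set Phi}).
Hypotheses (Phi_root : root_system ip Phi) (P_pos : positive_system P).
Local Notation C := (R[i]).
Local Notation ropp := (ropp Phi_root).
Local Notation t := (t_ P).
Local Notation x := (x_ P).
Local Notation y := (y_ P).
Local Notation word := (lieword C (ell_gen Phi)).
Local Notation cls := (wclass (ell_rel P)).
Implicit Types (i j l : Phi) (u v w : cplxn E).

Lemma positive_ropp i : (ropp i \in P) = (i \notin P).
Proof.
have [h [hP ->]] := P_pos; rewrite !inE val_ropp opp_lfunE oppr_gt0 -leNgt le_eqVlt.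
by rewrite (negPf (hP i)).
Qed.

Lemma sum_positive (V : lmodType C) (F : Phi -> V) : (forall i, F (ropp i) = F i) ->
  \sum_(i in P) F i = 2^-1 *: \sum_i F i.
Proof.
move=> FN; rewrite (bigID (fun i => i \in P) xpredT) /=.
rewrite [X in _ + X](reindex_inj (inv_inj (roppK Phi_root))) /=.
rewrite [X in _ + X](eq_bigl (fun i => i \in P)); last first.
  by move=> i; rewrite positive_ropp negbK.
rewrite [X in _ + X](eq_bigr F); last by move=> i _; apply: FN.
set S := LHS; rewrite -[S in S + S]scale1r -scalerDl scalerA mulVf ?scale1r //.
by rewrite pnatr_eq0.
Qed.

Lemma x_linear : linear x.
Proof.
move=> k u v; rewrite /x_ /pgen (cls_rel (ell_x_linear P k u v)).
by rewrite cls_add cls_scale.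
Qed.

Lemma y_linear : linear y.
Proof.
move=> k u v; rewrite /y_ /pgen (cls_rel (ell_y_linear P k u v)).
by rewrite cls_add cls_scale.
Qed.

Lemma t_ropp i : t (ropp i) = t i.
Proof. by apply: cls_rel; apply: ell_tN; rewrite val_ropp. Qed.

Lemma xx u v : [br x u, x v] = 0.
Proof. by have := cls_rel (ell_xx P u v); rewrite cls_br. Qed.

Lemma yy u v : [br y u, y v] = 0.
Proof. by have := cls_rel (ell_yy P u v); rewrite cls_br. Qed.

Lemma tx i u : pr i u = 0 -> [br t i, x u] = 0.
Proof. by move=> iu; have := cls_rel (ell_tx P iu); rewrite cls_br. Qed.

Lemma ty i u : pr i u = 0 -> [br t i, y u] = 0.
Proof. by move=> iu; have := cls_rel (ell_ty P iu); rewrite cls_br. Qed.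

Lemma yx u v : [br y u, x v] = 2^-1 *: \sum_i (pr i v * pr i u) *: t i.
Proof.
have := cls_rel (ell_yx P u v); rewrite cls_br => ->; rewrite cls_sum.
rewrite -sum_positive; last by move=> i; rewrite !pr_ropp mulrNN t_ropp.
by apply: eq_bigr => i _; rewrite cls_scale.
Qed.

Lemma t_positive_subsystem (Psi : {set Phi}) i :
  root_subsystem Psi -> root_rank Psi = 2%N -> i \in Psi ->
  [br t i, \sum_(j in Psi :&: P) t j] = 0.
Proof.
move=> s r iP; have := cls_rel (ell_tt P s r iP).
by rewrite cls_br cls_sum.
Qed.

Lemma root_subsystem_ropp (Psi : {set Phi}) i :
  root_subsystem Psi -> i \in Psi -> ropp i \in Psi.
Proof.
move=> s /s[c e]; apply/s; exists [ffun l => - c l].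
by rewrite val_ropp e -sumrN; apply: eq_bigr => l _; rewrite ffunE mulrNz.
Qed.

(** A subsystem is closed under negation, so its positive half carries half of
    the sum. *)
Lemma t_subsystem (Psi : {set Phi}) i :
  root_subsystem Psi -> root_rank Psi = 2%N -> i \in Psi ->
  \sum_(j in Psi) [br t i, t j] = 0.
Proof.
move=> s r iP; have := t_positive_subsystem s r iP; rewrite liebr_sumr.
pose F j := if j \in Psi then [br t i, t j] else 0.
have FN j : F (ropp j) = F j.
  rewrite /F t_ropp; suff -> : (ropp j \in Psi) = (j \in Psi) by [].
  apply/idP/idP => H; last exact: root_subsystem_ropp.
  by rewrite -(roppK Phi_root j); apply: root_subsystem_ropp.
have -> : \sum_(j in Psi :&: P) [br t i, t j] = \sum_(j in P) F j.
  rewrite -big_mkcondr; apply: eq_bigl => j; rewrite inE andbC //.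
rewrite (sum_positive FN) => /eqP; rewrite scaler_eq0 invr_eq0 pnatr_eq0 /=.
by move=> /eqP e; rewrite big_mkcond.
Qed.

Lemma string_rel a b : b != a -> b != ropp a ->
  \sum_(j | same_string a b j) [br t a, t j] = 0.
Proof. exact: (string_relation t_ropp t_subsystem). Qed.

Lemma pr_h i : pr i (hvec ip i) = 1.
Proof. exact: pr_hvec. Qed.

(** The criterion derivation_presented for the elliptic relations, where sums over
    positive roots become half sums over all roots. *)
Lemma elliptic_derivation (dt : Phi -> t_ell P) (dx dy : cplxn E -> t_ell P) :
  (forall i, dt (ropp i) = dt i) -> linear dx -> linear dy ->
  (forall (Psi : {set Phi}) i,
     root_subsystem Psi -> root_rank Psi = 2%N -> i \in Psi ->
     [br dt i, \sum_(j in Psi :&: P) t j] + [br t i, \sum_(j in Psi :&: P) dt j] = 0) ->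
  (forall u v, [br dx u, x v] + [br x u, dx v] = 0) ->
  (forall u v, [br dy u, y v] + [br y u, dy v] = 0) ->
  (forall u v, [br dy u, x v] + [br y u, dx v] =
     2^-1 *: \sum_i (pr i v * pr i u) *: dt i) ->
  (forall i u, pr i u = 0 -> [br dt i, x u] + [br t i, dx u] = 0) ->
  (forall i u, pr i u = 0 -> [br dt i, y u] + [br t i, dy u] = 0) ->
  exists D : Der (t_ell P), [/\ forall i, D (t i) = dt i,
    forall u, D (x u) = dx u & forall u, D (y u) = dy u].
Proof.
move=> dtN lx ly tt dxx dyy dyx dtx dty.
pose g (a : ell_gen Phi) : t_ell P :=
  match a with ell_t i => dt i | ell_x u => dx u | ell_y u => dy u end.
have dsum (I : Type) (r : seq I) (Q : pred I) (F : I -> word) :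
    dword (rel := ell_rel P) g (\big[@WAdd _ _/WZero]_(i <- r | Q i) F i) =
    \sum_(i <- r | Q i) dword (rel := ell_rel P) g (F i).
  by apply: (big_morph (dword (rel := ell_rel P) g)).
have [|D DE] := @derivation_presented _ _ (ell_rel P) g.
  move=> _ _ [i j e|k u v|k u v|Psi i s r iP|u v|u v|u v|i u iu|i u iu] /=.
  - have -> : j = ropp i by apply/val_inj; rewrite val_ropp.
    exact: dtN.
  - exact: lx.
  - exact: ly.
  - by rewrite dsum cls_sum; apply: tt.
  - exact: dxx.
  - exact: dyy.
  - rewrite dsum [LHS]dyx -sum_positive //.
    by move=> i; rewrite !pr_ropp mulrNN dtN.
  - exact: dtx.
  - exact: dty.
by exists D; split=> a; apply: DE.
Qed.

Lemma elliptic_derivation_unique (D D' : Der (t_ell P)) :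
  (forall i, D (t i) = D' (t i)) -> (forall u, D (x u) = D' (x u)) ->
  (forall u, D (y u) = D' (y u)) -> D = D'.
Proof.
by move=> et ex ey; apply: derivation_presented_unique => -[i|u|u];
  [apply: et|apply: ex|apply: ey].
Qed.

Local Notation tau := (tau (@hvec R E ip Phi) t x).
Local Notation delta_y := (delta_y (@hvec R E ip Phi) t x).
Local Notation alt_sum := (alt_sum (@hvec R E ip Phi) t x).

Lemma half_adE i : half_ad ip (P := P) i = liebr (x (hvec ip i)).
Proof.
by apply/funext => z; rewrite /half_ad /hvec (is_linearZ x_linear).
Qed.

Lemma tilde_delta_tE m i : tilde_delta_t ip P m i = [br t i, tau i (2 * m)].
Proof. by rewrite /tilde_delta_t half_adE. Qed.

Lemma tilde_delta_yE n m u : (2 * m)%N = n.+1 -> tilde_delta_y ip P m u = delta_y n u.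
Proof.
move=> e; have on : odd n by have := oddM 2 m; rewrite e /= => /negbFE.
rewrite /tilde_delta_y /delta_y e /=.
have S i : \sum_(p < n.+1) [br iter p (half_ad ip i) (t i),
    iter (n - p) (fun a : t_ell P => - half_ad ip i a) (t i)] = alt_sum n i.
  apply: eq_bigr => p _; rewrite half_adE -liebrZr; congr [br _, _].
  elim: (n - p)%N => [|q IH]; first by rewrite scale1r.
  by rewrite iterS IH liebrZr exprS mulN1r scaleNr.
under eq_bigr => i _ do rewrite S.
rewrite sum_positive => [|i]; last first.
  rewrite -/(pr (ropp i) u) pr_ropp (alt_sum_ropp pr_h x_linear t_ropp xx tx i on).
  by rewrite scalerN scaleNr opprK.
by rewrite scalerA -invfM -natrM.
Qed.

Lemma d_derivation : exists D : Der (t_ell P), tilde_formulas ip d_d D.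
Proof.
have [|||||||||D [Dt Dx Dy]] :=
    @elliptic_derivation (fun=> 0) x (fun u => - y u); last by exists D.
- by [].
- exact: x_linear.
- by move=> k u v; rewrite y_linear opprD scalerN.
- by move=> Psi i _ _ _ /=; rewrite liebr0l add0r big1 ?liebr0r.
- by move=> u v /=; rewrite xx addr0.
- by move=> u v /=; rewrite liebrNl liebrNr yy oppr0 addr0.
- move=> u v /=; rewrite liebrNl addNr big1 ?scaler0 // => i _; exact: scaler0.
- by move=> i u iu /=; rewrite liebr0l add0r tx.
- by move=> i u iu /=; rewrite liebr0l add0r liebrNr ty ?oppr0.
Qed.

Lemma X_derivation : exists D : Der (t_ell P), tilde_formulas ip d_X D.
Proof.
have [|||||||||D [Dt Dx Dy]] := @elliptic_derivation (fun=> 0) (fun=> 0) x; last by exists D.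
- by [].
- by move=> k u v; rewrite scaler0 addr0.
- exact: x_linear.
- by move=> Psi i _ _ _ /=; rewrite liebr0l add0r big1 ?liebr0r.
- by move=> u v /=; rewrite liebr0l liebr0r addr0.
- move=> u v /=; rewrite (liebrC (x u)) !yx addrC -scalerBr -sumrB big1 ?scaler0 // => i _.
  by rewrite mulrC subrr.
- move=> u v /=; rewrite xx liebr0r addr0 big1 ?scaler0 // => i _; exact: scaler0.
- by move=> i u iu /=; rewrite liebr0l liebr0r addr0.
- by move=> i u iu /=; rewrite liebr0l add0r tx.
Qed.

Lemma Delta0_derivation : exists D : Der (t_ell P), tilde_formulas ip d_Delta0 D.
Proof.
have [|||||||||D [Dt Dx Dy]] := @elliptic_derivation (fun=> 0) y (fun=> 0); last by exists D.
- by [].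
- exact: y_linear.
- by move=> k u v; rewrite scaler0 addr0.
- by move=> Psi i _ _ _ /=; rewrite liebr0l add0r big1 ?liebr0r.
- move=> u v /=; rewrite (liebrC (x u)) !yx -scalerBr -sumrB big1 ?scaler0 // => i _.
  by rewrite mulrC subrr.
- by move=> u v /=; rewrite liebr0l liebr0r addr0.
- move=> u v /=; rewrite yy liebr0l addr0 big1 ?scaler0 // => i _; exact: scaler0.
- by move=> i u iu /=; rewrite liebr0l add0r ty.
- by move=> i u iu /=; rewrite liebr0l liebr0r addr0.
Qed.

Let half_pred m : (0 < m)%N -> exists n, (2 * m)%N = n.+1 /\ odd n.
Proof.
case: m => // m _; exists (2 * m).+1; split; first by rewrite mulnS.
by rewrite /= mul2n odd_double.
Qed.

Lemma delta_derivation m (m0 : (0 < m)%N) :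
  exists D : Der (t_ell P), tilde_formulas ip (d_delta m0) D.
Proof.
have [n [mn on]] := half_pred m0; have ek : ~~ odd n.+1 by rewrite /= on.
have brV i : [br t i, tau i n.+1] = [br t i, tau_total (@hvec R E ip Phi) t x n.+1].
  exact: (br_tau_total pr_h x_linear t_ropp string_rel xx tx i ek).
have xtau u i k : pr i u = 0 -> [br x u, tau i k] = 0.
  by move=> iu; rewrite (brx_tau pr_h x_linear xx tx) iu scale0r.
have [|||||||||D [Dt Dx Dy]] :=
    @elliptic_derivation (fun i => [br t i, tau i n.+1]) (fun=> 0) (delta_y n).
- move=> i; rewrite (tau_ropp pr_h x_linear t_ropp xx tx) t_ropp.
  by rewrite -signr_odd (negPf ek) scale1r.
- by move=> k u v; rewrite scaler0 addr0.
- exact: delta_y_linear.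
- move=> Psi i s r iP; have e := t_positive_subsystem s r iP.
  have -> : \sum_(j in Psi :&: P) [br t j, tau j n.+1] =
      \sum_(j in Psi :&: P) [br t j, tau_total (@hvec R E ip Phi) t x n.+1].
    by apply: eq_bigr => j _; apply: brV.
  rewrite brV.
  by rewrite -liebr_suml [X in _ + X]liebr_leibniz e liebr0l add0r liebrC addNr.
- by move=> u v /=; rewrite liebr0l liebr0r addr0.
- move=> u v; have n1 : n.-1.+1 = n := prednK (odd_gt0 on).
  have en : ~~ odd n.-1 by rewrite -oddS n1.
  by have := delta_y_comm pr_h x_linear y_linear t_ropp string_rel xx yx tx ty u v en;
    rewrite n1.
- move=> u v /=; rewrite liebr0r addr0.
  exact: (br_delta_y_x pr_h x_linear xx tx).
- move=> i u iu /=; rewrite liebr0r addr0 liebrC liebr_leibniz.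
  by rewrite (xtau u i 0%N iu) (xtau u i n.+1 iu) liebr0r liebr0l addr0 oppr0.
- move=> i u iu /=; rewrite (br_t_delta_y pr_h x_linear t_ropp string_rel xx yx tx ty iu on).
  rewrite liebrC liebr_leibniz (liebrC (y u) (t i)) ty // oppr0 liebr0l add0r.
  by rewrite addNr.
exists D; split=> [//|i|u]; first by rewrite Dt tilde_delta_tE mn.
by rewrite Dy (tilde_delta_yE _ mn).
Qed.

Lemma tilde_derivation xi : exists! D : Der (t_ell P), tilde_formulas ip xi D.
Proof.
have [D DP] : exists D : Der (t_ell P), tilde_formulas ip xi D.
  case: xi => [|||m m0]; [exact: Delta0_derivation|exact: d_derivation|
    exact: X_derivation|exact: delta_derivation].
exists D; split=> // D'; case: xi DP => [|||m m0] [D1 D2 D3] [D1' D2' D3'];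
  apply: elliptic_derivation_unique => a; by rewrite ?D1 ?D2 ?D3 ?D1' ?D2' ?D3'.
Qed.

Lemma br_derE (D D' : Der (t_ell P)) a : [br D, D'] a = D (D' a) - D' (D a).
Proof. by []. Qed.

Lemma scale_derE k (D : Der (t_ell P)) a : (k *: D) a = k *: D a.
Proof. by []. Qed.

Lemma zero_derE a : (0 : Der (t_ell P)) a = 0.
Proof. by []. Qed.

(** Iterated commutators with Delta0 act on y(u) and on t_alpha by powers of
    Delta0 alone, because Delta0 kills these generators. *)
Lemma iter_br_der (D D0 : Der (t_ell P)) N a : D0 a = 0 ->
  iter N (liebr D0) D a = iter N D0 (D a).
Proof.
by move=> a0; elim: N => [//|N IH]; rewrite iterS br_derE IH a0 der0 subr0.
Qed.

Lemma iter_br_der_x (D D0 : Der (t_ell P)) N u :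
  D0 (x u) = y u -> D0 (y u) = 0 -> D (x u) = 0 ->
  iter N.+1 (liebr D0) D (x u) = - N.+1%:R *: iter N D0 (D (y u)).
Proof.
move=> D0x D0y Dx; elim: N => [|N IH].
  by rewrite [iter 1 _ _]/(liebr _ _) br_derE Dx der0 D0x sub0r scaleN1r.
rewrite iterS br_derE IH D0x iter_br_der // derZ -iterS -[X in _ - X]scale1r.
by rewrite -scalerBl -opprD natr1.
Qed.

Lemma tilde_relations (g : d_gen -> Der (t_ell P)) :
  (forall xi, tilde_formulas ip xi (g xi)) ->
  forall s s', @d_rel R s s' -> evalword g s = evalword g s'.
Proof.
move=> gP; have [D0x D0y D0t] := gP d_Delta0; have [dx dy dt] := gP d_d.
have [Xx Xy Xt] := gP d_X.
move=> _ _ [|||m m0|m m0|m m0]; last 3 first.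
- have [n [mn on]] := half_pred m0; have [ex et ey] := gP (d_delta m0).
  have {}ey u : g (d_delta m0) (y u) = delta_y n u by rewrite ey (tilde_delta_yE _ mn).
  have {}et i : g (d_delta m0) (t i) = [br t i, tau i n.+1].
    by rewrite et tilde_delta_tE mn.
  rewrite /=; apply: elliptic_derivation_unique => [i|u|u]; rewrite zero_derE br_derE.
  + rewrite Xt der0 sub0r et der_br_leibniz Xt liebr0l add0r.
    by rewrite (der_tau_killed _ Xt Xx) liebr0r oppr0.
  + by rewrite Xx ex !der0 subr0.
  + by rewrite Xy ex ey (der_delta_y_killed _ Xt Xx) subr0.
- have [n [mn on]] := half_pred m0; have [ex et ey] := gP (d_delta m0).
  have {}ey u : g (d_delta m0) (y u) = delta_y n u by rewrite ey (tilde_delta_yE _ mn).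
  have {}et i : g (d_delta m0) (t i) = [br t i, tau i n.+1].
    by rewrite et tilde_delta_tE mn.
  rewrite /=; apply: elliptic_derivation_unique => [i|u|u]; rewrite scale_derE br_derE mn.
  + rewrite dt der0 subr0 et der_br_leibniz dt liebr0l add0r.
    by rewrite (der_tau_degree _ dt dx) liebrZr.
  + by rewrite dx ex !der0 subr0 scaler0.
  + rewrite dy derN ey (der_delta_y_degree _ dt dx) opprK.
    by rewrite -[X in _ + X]scale1r -scalerDl natr1.
- have [n [mn on]] := half_pred m0; have [ex et ey] := gP (d_delta m0).
  have {}ey u : g (d_delta m0) (y u) = delta_y n u by rewrite ey (tilde_delta_yE _ mn).
  have {}et i : g (d_delta m0) (t i) = [br t i, tau i n.+1].
    by rewrite et tilde_delta_tE mn.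
  have -> : evalword g (iter (2 * m).+1 (WBr (WGen d_Delta0)) (WGen (d_delta m0))) =
      iter n.+2 (liebr (g d_Delta0)) (g (d_delta m0)).
    by rewrite mn; elim: n.+2 => [//|N IH]; rewrite [LHS]/= IH.
  rewrite [RHS]/=; apply: elliptic_derivation_unique => [i|u|u]; rewrite zero_derE.
  + rewrite iter_br_der // et; exact: (der_br_t_tau_nilp _ D0t D0x D0y).
  + rewrite (iter_br_der_x _ (D0x u) (D0y u) (ex u)) ey.
    by rewrite (der_delta_y_nilp _ D0t D0x D0y) scaler0.
  + by rewrite iter_br_der // ey iterS (der_delta_y_nilp _ D0t D0x D0y) der0.
- rewrite /=; apply: elliptic_derivation_unique => [i|u|u]; rewrite scale_derE br_derE.
  + by rewrite Xt dt !der0 subr0 scaler0.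
  + by rewrite Xx dx Xx der0 subr0 scaler0.
  + by rewrite Xy dy derN Xy dx opprK -mulr2n -[LHS]scaler_nat.
- rewrite /=; apply: elliptic_derivation_unique => [i|u|u]; rewrite scale_derE br_derE.
  + by rewrite D0t dt !der0 subr0 scaler0.
  + by rewrite D0x dx D0x dy -opprD scaleNr -mulr2n -[X in - X = _]scaler_nat.
  + by rewrite D0y dy derN D0y der0 oppr0 subr0 scaler0.
- rewrite /=; apply: elliptic_derivation_unique => [i|u|u]; rewrite br_derE.
  + by rewrite D0t Xt !der0 subr0 dt.
  + by rewrite D0x Xy Xx der0 subr0 dx.
  + by rewrite D0y Xy D0x der0 sub0r dy.
Qed.

End EllipticPresentation.

Theorem proposition6p1 (R : realType) (E : vectType R) (ip : {dot E for idfun})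
    (Phi : {fset 'Hom(E, R^o)}) (P : {set Phi})
    (Phi_root : root_system ip Phi) (P_pos : positive_system P) :
  (forall xi : d_gen, exists! D : Der (t_ell P), tilde_formulas ip xi D) /\
  exists! tilde : d_lie R -> Der (t_ell P),
    lie_morphism tilde /\
    forall xi : d_gen, tilde_formulas ip xi (tilde (d_elt R xi)).
Proof.
have D1 := tilde_derivation Phi_root P_pos; split=> //.
have /choice[g gP] : forall xi, exists D : Der (t_ell P), tilde_formulas ip xi D.
  by move=> xi; have [D [DP _]] := D1 xi; exists D.
have [f [fm fE]] := morphism_presented (tilde_relations Phi_root P_pos gP).
exists f; split; first by split=> // xi; rewrite /d_elt fE.
move=> f' [f'm f'P]; apply: morphism_presented_unique => // xi.
have [D [_ DU]] := D1 xi; rewrite -(DU _ (f'P xi)); symmetry; apply: DU.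
by rewrite fE.
Qed.
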